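(* A formal series $\tilde\varphi\in\mathbb{C}[[z^{-1}]]$ is resurgent if and only if there exists a discrete filtered set $\Omega$ such that $\tilde\varphi$ is $\Omega$-resurgent. In other words, $$\hat{\mathscr{R}}=\bigcup_{\Omega\ \text{d.f.s.}}\hat{\mathscr{R}}_\Omega,\qquad \tilde{\mathscr{R}}=\bigcup_{\Omega\ \text{d.f.s.}}\tilde{\mathscr{R}}_\Omega .$$
   Context: A convergent power series $\hat\varphi\in\mathbb{C}\{\zeta\}$ is endlessly continuable if for every $L>0$ there is a finite $F_L\subset\mathbb{C}$ such that $\hat\varphi$ can be analytically continued along every Lipschitz path $\gamma:[0,1]\to\mathbb{C}$ of length $<L$ with $\gamma(0)=0$ and $\gamma((0,1])\subset\mathbb{C}\setminus F_L$; $\hat{\mathscr{R}}$ denotes the space of such functions. The formal Borel transform $\mathcal{B}:\mathbb{C}[[z^{-1}]]\to\mathbb{C}\delta\oplus\mathbb{C}[[\zeta]]$ sends $\sum_{j\ge0}\varphi_jz^{-j}$ to $\varphi_0\delta+\sum_{j\ge1}\varphi_j\zeta^{j-1}/(j-1)!$; $\tilde{\mathscr{R}}=\mathcal{B}^{-1}(\mathbb{C}\delta\oplus\hat{\mathscr{R}})$ is the space of resurgent series. A discrete filtered set (d.f.s.) is a family $\Omega=(\Omega_L)_{L\ge0}$ of finite subsets of $\mathbb{C}$ with $\Omega_{L_1}\subseteq\Omega_{L_2}$ for $L_1\le L_2$ and $\Omega_\delta=\emptyset$ for some $\delta>0$. Let $\mathcal{S}_\Omega=\{(\lambda,\omega)\in\mathbb{R}\times\mathbb{C}\mid\lambda\ge0,\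 \omega\in\Omega_\lambda\}$ and $\mathcal{M}_\Omega=(\mathbb{R}\times\mathbb{C})\setminus\overline{\mathcal{S}_\Omega}$. Let $\Pi$ be the set of Lipschitz paths $\gamma:[0,t_*]\to\mathbb{C}$ ($t_*\ge0$) with $\gamma(0)=0$; for $t\in[0,t_*]$, $\gamma_{|t}$ denotes the restriction to $[0,t]$ and $L(\cdot)$ denotes length. A path $\gamma\in\Pi$ is $\Omega$-allowed if $(L(\gamma_{|t}),\gamma(t))\in\mathcal{M}_\Omega$ for all $t$. A germ $\hat\varphi\in\mathbb{C}\{\zeta\}$ is $\Omega$-continuable if it can be analytically continued along every $\Omega$-allowed path; $\hat{\mathscr{R}}_\Omega$ is the set of such germs, and $\tilde{\mathscr{R}}_\Omega=\mathcal{B}^{-1}(\mathbb{C}\delta\oplus\hat{\mathscr{R}}_\Omega)$ is the set of $\Omega$-resurgent series. *)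

(* Defs.v *)
From Stdlib Require Import Reals List Factorial.
From Coquelicot Require Import Coquelicot.
Open Scope R_scope.

Fixpoint var_sum (gamma : R -> C) (p : nat -> R) (n : nat) : R :=
  match n with
  | O => 0
  | S k => var_sum gamma p k + Cmod (Cminus (gamma (p (S k))) (gamma (p k)))
  end.

Definition partition_of (t : R) (p : nat -> R) (n : nat) : Prop :=
  p O = 0 /\ p n = t /\ (forall i, (i < n)%nat -> p i <= p (S i)).

Definition path_length (gamma : R -> C) (t : R) : R :=
  real (Lub_Rbar (fun l => exists p n, partition_of t p n /\ l = var_sum gamma p n)).

Definition lipschitz_on (gamma : R -> C) (T : R) : Prop :=
  exists K : R, forall s t, 0 <= s <= T -> 0 <= t <= T ->
    Cmod (Cminus (gamma s) (gamma t)) <= K * Rabs (s - t).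

Definition in_Pi (gamma : R -> C) (T : R) : Prop :=
  0 <= T /\ lipschitz_on gamma T /\ gamma 0 = RtoC 0.

(* a convergent power series sum a_n zeta^n: positive radius of convergence *)
Definition convergent (a : nat -> C) : Prop :=
  exists r : R, 0 < r /\ exists M : R, forall n, Cmod (a n) * r ^ n <= M.

Definition holo_on_disc (f : C -> C) (c : C) (r : R) : Prop :=
  forall z, Cmod (Cminus z c) < r -> @ex_derive C_AbsRing C_NormedModule f z.

Definition continuable_along (a : nat -> C) (gamma : R -> C) (T : R) : Prop :=
  exists (f : R -> C -> C) (r : R -> R),
    (forall t, 0 <= t <= T -> 0 < r t /\ holo_on_disc (f t) (gamma t) (r t)) /\
    (exists eps, 0 < eps /\ forall z, Cmod z < eps ->
        @is_series C_AbsRing C_NormedModule (fun n => Cmult (a n) (Cpow z n)) (f 0 z)) /\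
    (forall t, 0 <= t <= T -> exists delta, 0 < delta /\
       forall s, 0 <= s <= T -> Rabs (s - t) < delta ->
         Cmod (Cminus (gamma s) (gamma t)) < r t /\
         exists eps, 0 < eps /\ forall z, Cmod (Cminus z (gamma s)) < eps -> f s z = f t z).

Definition endlessly_continuable (a : nat -> C) : Prop :=
  forall L : R, 0 < L -> exists F : list C,
    forall gamma : R -> C,
      in_Pi gamma 1 -> path_length gamma 1 < L ->
      (forall t, 0 < t <= 1 -> ~ In (gamma t) F) ->
      continuable_along a gamma 1.

Definition hatR (a : nat -> C) : Prop := convergent a /\ endlessly_continuable a.

Definition finite_set (A : C -> Prop) : Prop :=
  exists l : list C, forall w, A w <-> In w l.

Definition dfs (Omega : R -> C -> Prop) : Prop :=
  (forall L, 0 <= L -> finite_set (Omega L)) /\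
  (forall L1 L2 w, 0 <= L1 -> L1 <= L2 -> Omega L1 w -> Omega L2 w) /\
  (exists delta, 0 < delta /\ forall w, ~ Omega delta w).

Definition S_Omega (Omega : R -> C -> Prop) (lam : R) (w : C) : Prop :=
  0 <= lam /\ Omega lam w.

Definition in_closure_S (Omega : R -> C -> Prop) (lam : R) (w : C) : Prop :=
  forall eps, 0 < eps -> exists lam' w', S_Omega Omega lam' w' /\
    Rabs (lam - lam') < eps /\ Cmod (Cminus w w') < eps.

Definition M_Omega (Omega : R -> C -> Prop) (lam : R) (w : C) : Prop :=
  ~ in_closure_S Omega lam w.

Definition Omega_allowed (Omega : R -> C -> Prop) (gamma : R -> C) (T : R) : Prop :=
  in_Pi gamma T /\
  forall t, 0 <= t <= T -> M_Omega Omega (path_length gamma t) (gamma t).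

Definition Omega_continuable (Omega : R -> C -> Prop) (a : nat -> C) : Prop :=
  forall (gamma : R -> C) (T : R), Omega_allowed Omega gamma T -> continuable_along a gamma T.

Definition hatR_Omega (Omega : R -> C -> Prop) (a : nat -> C) : Prop :=
  convergent a /\ Omega_continuable Omega a.

(* A formal series sum_{j>=0} phi j z^{-j} is given by phi : nat -> C.
   Its formal Borel transform is phi 0 delta + sum_{j>=1} phi j zeta^{j-1}/(j-1)!;
   [borel_part phi] is the coefficient sequence of the C[[zeta]] component. *)
Definition borel_part (phi : nat -> C) : nat -> C :=
  fun k => Cdiv (phi (S k)) (RtoC (INR (fact k))).

(* tilde R = B^{-1}(C delta + hat R) *)
Definition resurgent (phi : nat -> C) : Prop := hatR (borel_part phi).

Definition Omega_resurgent (Omega : R -> C -> Prop) (phi : nat -> C) : Prop :=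
  hatR_Omega Omega (borel_part phi).

(* Main.v *)
Require Import Defs.
From Stdlib Require Import Reals List Lra Lia Classical ClassicalEpsilon.
From Coquelicot Require Import Coquelicot.
Open Scope R_scope.

(** If [Omega] is a discrete filtered set, then [F_L := Omega_L] works, because a closure
    point [(lam, w)] of [S_Omega] with [lam < L] has [w] in [Omega_L].

    Conversely, let [Omega_lam] consist of the end points [w] of the paths of length at most
    [lam] along which the germ can be continued up to, but not including, [w].  By
    construction nothing obstructs continuation along an [Omega]-allowed path.  The point is
    that [Omega_lam] is finite: it is contained in [F_L] for every [L > lam].  Indeed, if [w]
    is not in [F_L], the path to [w], stopped shortly before [w], can be replaced by a slightly
    longer polygon avoiding [F_L] with the same terminal germ, and following the original path
    from there to [w] shows that [w] is not singular.

    The comparison of germs rests on the identity theorem for functions that are merely complex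
    differentiable.  By Goursat's theorem such an [f] has a second primitive [H]; if [f]
    vanishes near [q] then so does [H], and the maximum principle for [H / (z - q)^n], proved
    with the second derivative test, gives [H = 0] on letting [n] grow. *)

(** The path that leads to a singular point may itself run through [F_L], even infinitely often, so
    endless continuability says nothing about it directly. The way around is that each of its germs
    lives on a disc, inside which the vertices of a polygon can be moved freely; choosing them off
    finitely many lines makes every edge miss [F_L]. The origin may belong to [F_L], hence edges are
    only required to avoid it after their start. The strict gap L - lam pays for the detour. Endless
    continuability then applies to the polygon followed by the tail of the path, but it provides
    some family of germs with no given relation to the original one; uniqueness of continuation
    identifies the two at the junction, and this is where the identity theorem enters. Two
    primitives are taken because the maximum principle uses second derivatives, whereas nothing is
    known about the regularity of the derivative of f. In the other direction the time t = 0 is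
    special, since the path may start in [F_L]: there the empty set [Omega_delta] keeps (0, 0) away
    from the closure of [S_Omega]. *)

Lemma Cmod_sub_comm (a b : C) : Cmod (a - b) = Cmod (b - a).
Proof. rewrite <- Cmod_opp. f_equal. ring. Qed.

Lemma Cmod_sub_triangle (b a c : C) : Cmod (a - c) <= Cmod (a - b) + Cmod (b - c).
Proof. replace (a - c)%C with ((a - b) + (b - c))%C by ring. apply Cmod_triangle. Qed.

Lemma Cmod_sub_self (a : C) : Cmod (a - a) = 0.
Proof. replace (a - a)%C with (RtoC 0) by ring. apply Cmod_0. Qed.

Lemma fst_le_Cmod (z : C) : Rabs (fst z) <= Cmod z.
Proof. eapply Rle_trans; [apply Rmax_l | apply Rmax_Cmod]. Qed.

Lemma snd_le_Cmod (z : C) : Rabs (snd z) <= Cmod z.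
Proof. eapply Rle_trans; [apply Rmax_r | apply Rmax_Cmod]. Qed.

Lemma Cmod_le_abs_add (z : C) : Cmod z <= Rabs (fst z) + Rabs (snd z).
Proof.
  replace z with ((fst z : C) + Ci * (snd z : C))%C at 1
    by (apply injective_projections; simpl; ring).
  eapply Rle_trans; [apply Cmod_triangle|].
  rewrite Cmod_mult, Cmod_Ci, !Cmod_R. lra.
Qed.

Lemma Cmod_sub_bounds (z w : C) :
  Rabs (fst z - fst w) <= Cmod (z - w) /\ Rabs (snd z - snd w) <= Cmod (z - w) /\
  Cmod (z - w) <= Rabs (fst z - fst w) + Rabs (snd z - snd w).
Proof.
  split; [|split]; [apply (fst_le_Cmod (z - w)) | apply (snd_le_Cmod (z - w))
  | apply (Cmod_le_abs_add (z - w))].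
Qed.

(** * Complex derivatives and contour integrals over rectangles *)

(** The division-free form of complex differentiability: w = z needs no exception, and error
    estimates become plain inequalities between moduli. *)
Definition cderiv (f : C -> C) (z l : C) : Prop :=
  forall eps, 0 < eps -> exists d, 0 < d /\ forall w, Cmod (w - z) < d ->
    Cmod (f w - f z - l * (w - z)) <= eps * Cmod (w - z).

Definition ccont (f : C -> C) (z : C) : Prop :=
  forall eps, 0 < eps -> exists d, 0 < d /\ forall w, Cmod (w - z) < d ->
    Cmod (f w - f z) < eps.

Lemma is_derive_cderiv (f : C -> C) (z l : C) :
  @is_derive C_AbsRing C_NormedModule f z l -> cderiv f z l.
Proof.
  intros [_ H] eps Heps.
  destruct (H z (fun P HP => HP) (mkposreal eps Heps)) as [d Hd].
  exists d; split; [apply cond_pos|]. intros w Hw.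
  specialize (Hd w Hw).
  replace (l * (w - z))%C with ((w - z) * l)%C by ring. exact Hd.
Qed.

Lemma cderiv_ccont (f : C -> C) (z l : C) : cderiv f z l -> ccont f z.
Proof.
  intros H eps Heps. destruct (H 1 Rlt_0_1) as [d [Hd H1]].
  set (m := Cmod l). assert (Hm : 0 <= m) by apply Cmod_ge_0.
  exists (Rmin d (eps / (2 * (m + 1)))).
  assert (He : 0 < eps / (2 * (m + 1))) by (apply Rdiv_lt_0_compat; lra).
  split; [now apply Rmin_glb_lt|]. intros w Hw.
  assert (Hw1 := Rlt_le_trans _ _ _ Hw (Rmin_l _ _)).
  assert (Hw2 := Rlt_le_trans _ _ _ Hw (Rmin_r _ _)).
  specialize (H1 w Hw1).
  replace (f w - f z)%C with ((f w - f z - l * (w - z)) + l * (w - z))%C by ring.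
  eapply Rle_lt_trans; [apply Cmod_triangle|]. rewrite Cmod_mult. fold m.
  assert (Hx := Cmod_ge_0 (w - z)).
  assert ((m + 1) * Cmod (w - z) < (m + 1) * (eps / (2 * (m + 1))))
    by (apply Rmult_lt_compat_l; lra).
  replace ((m + 1) * (eps / (2 * (m + 1)))) with (eps / 2) in * by (field; lra).
  lra.
Qed.

Definition rcont (g : R -> C) (s : R) : Prop :=
  forall eps, 0 < eps -> exists d, 0 < d /\ forall t, Rabs (t - s) < d ->
    Cmod (g t - g s) < eps.

Lemma rcont_fst (g : R -> C) s : rcont g s -> continuous (fun t => fst (g t)) s.
Proof.
  intros H P [e He]. destruct (H e (cond_pos e)) as [d [Hd H1]].
  exists (mkposreal d Hd). intros t Ht. apply He.
  eapply Rle_lt_trans; [|exact (H1 t Ht)].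
  apply (proj1 (Cmod_sub_bounds _ _)).
Qed.

Lemma rcont_snd (g : R -> C) s : rcont g s -> continuous (fun t => snd (g t)) s.
Proof.
  intros H P [e He]. destruct (H e (cond_pos e)) as [d [Hd H1]].
  exists (mkposreal d Hd). intros t Ht. apply He.
  eapply Rle_lt_trans; [|exact (H1 t Ht)].
  apply (proj1 (proj2 (Cmod_sub_bounds _ _))).
Qed.

(** Taken componentwise, so that all integration theory comes from the real [RInt]; the price is the
    factor 2 in [Cmod_CInt_le]. *)
Definition CInt (g : R -> C) (a b : R) : C :=
  (RInt (fun s => fst (g s)) a b, RInt (fun s => snd (g s)) a b).

Definition ex_CInt (g : R -> C) (a b : R) : Prop :=
  ex_RInt (fun s => fst (g s)) a b /\ ex_RInt (fun s => snd (g s)) a b.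

Lemma ex_CInt_rcont (g : R -> C) a b :
  (forall s, Rmin a b <= s <= Rmax a b -> rcont g s) -> ex_CInt g a b.
Proof.
  intros H; split; apply (ex_RInt_continuous (V := R_CompleteNormedModule));
    intros s Hs; [apply rcont_fst | apply rcont_snd]; now apply H.
Qed.

Lemma CInt_Chasles g a b c : ex_CInt g a b -> ex_CInt g b c ->
  CInt g a c = (CInt g a b + CInt g b c)%C.
Proof.
  intros [H1 H2] [H3 H4]. symmetry. apply injective_projections; simpl.
  - exact (RInt_Chasles _ _ _ _ H1 H3).
  - exact (RInt_Chasles _ _ _ _ H2 H4).
Qed.

Lemma CInt_swap g a b : ex_CInt g a b -> CInt g b a = (- CInt g a b)%C.
Proof.
  intros [H1 H2]. symmetry. apply injective_projections; simpl.
  - exact (opp_RInt_swap _ _ _ H1).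
  - exact (opp_RInt_swap _ _ _ H2).
Qed.

Lemma CInt_minus g h a b : ex_CInt g a b -> ex_CInt h a b ->
  CInt (fun s => g s - h s)%C a b = (CInt g a b - CInt h a b)%C.
Proof.
  intros [H1 H2] [H3 H4]. apply injective_projections; simpl.
  - exact (RInt_minus _ _ _ _ H1 H3).
  - exact (RInt_minus _ _ _ _ H2 H4).
Qed.

Lemma ex_CInt_minus g h a b : ex_CInt g a b -> ex_CInt h a b ->
  ex_CInt (fun s => g s - h s)%C a b.
Proof.
  intros [H1 H2] [H3 H4]. split.
  - exact (ex_RInt_minus _ _ _ _ H1 H3).
  - exact (ex_RInt_minus _ _ _ _ H2 H4).
Qed.

Lemma abs_RInt_le_const' (f : R -> R) a b M : ex_RInt f a b ->
  (forall t, Rmin a b <= t <= Rmax a b -> Rabs (f t) <= M) ->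
  Rabs (RInt f a b) <= Rabs (b - a) * M.
Proof.
  intros Hex HM. destruct (Rle_dec a b) as [Hab|Hab].
  - rewrite (Rabs_pos_eq (b - a)) by lra. apply abs_RInt_le_const; auto.
    intros t Ht. apply HM. rewrite Rmin_left, Rmax_right; lra.
  - rewrite <- (opp_RInt_swap f b a) by now apply ex_RInt_swap.
    change opp with Ropp. rewrite Rabs_Ropp, Rabs_minus_sym, (Rabs_pos_eq (a - b)) by lra.
    apply abs_RInt_le_const; [lra | now apply ex_RInt_swap |].
    intros t Ht. apply HM. rewrite Rmin_right, Rmax_left; lra.
Qed.

Lemma Cmod_CInt_le g a b M : ex_CInt g a b ->
  (forall t, Rmin a b <= t <= Rmax a b -> Cmod (g t) <= M) ->
  Cmod (CInt g a b) <= 2 * M * Rabs (b - a).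
Proof.
  intros [H1 H2] HM. eapply Rle_trans; [apply Cmod_le_abs_add|]. simpl.
  assert (G1 : Rabs (RInt (fun s => fst (g s)) a b) <= Rabs (b - a) * M).
  { apply abs_RInt_le_const'; auto. intros t Ht.
    eapply Rle_trans; [apply fst_le_Cmod | auto]. }
  assert (G2 : Rabs (RInt (fun s => snd (g s)) a b) <= Rabs (b - a) * M).
  { apply abs_RInt_le_const'; auto. intros t Ht.
    eapply Rle_trans; [apply snd_le_Cmod | auto]. }
  lra.
Qed.

Lemma is_RInt_affine (u v a b : R) :
  is_RInt (fun s => u + v * s) a b (u * (b - a) + v * (b ^ 2 - a ^ 2) / 2).
Proof.
  replace (u * (b - a) + v * (b ^ 2 - a ^ 2) / 2) with
    (minus ((fun s => u * s + v * s ^ 2 / 2) b) ((fun s => u * s + v * s ^ 2 / 2) a))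
    by (unfold minus, plus, opp; simpl; field).
  apply (is_RInt_derive (V := R_CompleteNormedModule) (fun s => u * s + v * s ^ 2 / 2));
    intros x _.
  - auto_derive; auto. field.
  - apply (ex_derive_continuous (fun s => u + v * s)). auto_derive; auto.
Qed.

Lemma CInt_affine (u v : C) (a b : R) :
  ex_CInt (fun s => u + v * RtoC s)%C a b /\
  CInt (fun s => u + v * RtoC s)%C a b =
    (u * RtoC (b - a) + v * RtoC ((b ^ 2 - a ^ 2) / 2))%C.
Proof.
  assert (H1 : is_RInt (fun s => fst (u + v * RtoC s)%C) a b
                 (fst (u * RtoC (b - a) + v * RtoC ((b ^ 2 - a ^ 2) / 2))%C)).
  { eapply is_RInt_ext; [|evar_last; [apply (is_RInt_affine (fst u) (fst v))|]].
    - intros x _. simpl. ring.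
    - simpl. field. }
  assert (H2 : is_RInt (fun s => snd (u + v * RtoC s)%C) a b
                 (snd (u * RtoC (b - a) + v * RtoC ((b ^ 2 - a ^ 2) / 2))%C)).
  { eapply is_RInt_ext; [|evar_last; [apply (is_RInt_affine (snd u) (snd v))|]].
    - intros x _. simpl. ring.
    - simpl. field. }
  split; [split; eexists; eassumption|].
  apply injective_projections; unfold CInt; cbn [fst snd]; now apply is_RInt_unique.
Qed.

(** The contour integral of f dz around the rectangle, counterclockwise when a <= b and c <= d; on
    vertical sides dz = i dt. *)
Definition rect_int (f : C -> C) (a b c d : R) : C :=
  (CInt (fun s => f (s, c)) a b + Ci * CInt (fun t => f (b, t)) c d
   - CInt (fun s => f (s, d)) a b - Ci * CInt (fun t => f (a, t)) c d)%C.

(** Corners may come in any order, because primitives are compared at points in arbitrary relative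
    position. *)
Definition in_rect (a b c d : R) (z : C) : Prop :=
  Rmin a b <= fst z <= Rmax a b /\ Rmin c d <= snd z <= Rmax c d.

Lemma ccont_rcont_h f s y : ccont f (s, y) -> rcont (fun t => f (t, y)) s.
Proof.
  intros H eps He. destruct (H eps He) as [d [Hd H1]].
  exists d; split; auto. intros t Ht. apply H1.
  eapply Rle_lt_trans; [apply Cmod_le_abs_add|]. simpl.
  replace (y + - y) with 0 by ring. rewrite Rabs_R0. unfold Rminus in Ht. lra.
Qed.

Lemma ccont_rcont_v f x s : ccont f (x, s) -> rcont (fun t => f (x, t)) s.
Proof.
  intros H eps He. destruct (H eps He) as [d [Hd H1]].
  exists d; split; auto. intros t Ht. apply H1.
  eapply Rle_lt_trans; [apply Cmod_le_abs_add|]. simpl.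
  replace (x + - x) with 0 by ring. rewrite Rabs_R0. unfold Rminus in Ht. lra.
Qed.

Lemma ex_CInt_h f a b c d y : (forall z, in_rect a b c d z -> ccont f z) ->
  Rmin c d <= y <= Rmax c d -> forall a' b',
  Rmin a b <= a' <= Rmax a b -> Rmin a b <= b' <= Rmax a b ->
  ex_CInt (fun s => f (s, y)) a' b'.
Proof.
  intros Hf Hy a' b' Ha' Hb'. apply ex_CInt_rcont. intros s Hs.
  apply ccont_rcont_h, Hf. split; simpl; auto.
  revert Hs. unfold Rmin at 1, Rmax at 1. destruct (Rle_dec a' b'); lra.
Qed.

Lemma ex_CInt_v f a b c d x : (forall z, in_rect a b c d z -> ccont f z) ->
  Rmin a b <= x <= Rmax a b -> forall c' d',
  Rmin c d <= c' <= Rmax c d -> Rmin c d <= d' <= Rmax c d ->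
  ex_CInt (fun t => f (x, t)) c' d'.
Proof.
  intros Hf Hx c' d' Hc' Hd'. apply ex_CInt_rcont. intros s Hs.
  apply ccont_rcont_v, Hf. split; simpl; auto.
  revert Hs. unfold Rmin at 1, Rmax at 1. destruct (Rle_dec c' d'); lra.
Qed.

Lemma Rmin_Rmax_bounds a b : Rmin a b <= a <= Rmax a b /\ Rmin a b <= b <= Rmax a b.
Proof. unfold Rmin, Rmax; destruct (Rle_dec a b); lra. Qed.

(** Each inner side is traversed twice in opposite directions and cancels; the outer sides add up by
    Chasles. *)
Lemma rect_int_split f a b c d m n : (forall z, in_rect a b c d z -> ccont f z) ->
  a <= m <= b -> c <= n <= d ->
  rect_int f a b c d = (rect_int f a m c n + rect_int f m b c n
    + (rect_int f a m n d + rect_int f m b n d))%C.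
Proof.
  intros Hf Hm Hn. unfold rect_int.
  assert (Hab := Rmin_Rmax_bounds a b). assert (Hcd := Rmin_Rmax_bounds c d).
  assert (Hm' : Rmin a b <= m <= Rmax a b) by (rewrite Rmin_left, Rmax_right; lra).
  assert (Hn' : Rmin c d <= n <= Rmax c d) by (rewrite Rmin_left, Rmax_right; lra).
  rewrite (CInt_Chasles (fun s => f (s, c)) a m b) by (eapply ex_CInt_h; eauto; tauto).
  rewrite (CInt_Chasles (fun s => f (s, d)) a m b) by (eapply ex_CInt_h; eauto; tauto).
  rewrite (CInt_Chasles (fun s => f (a, s)) c n d) by (eapply ex_CInt_v; eauto; tauto).
  rewrite (CInt_Chasles (fun s => f (b, s)) c n d) by (eapply ex_CInt_v; eauto; tauto).
  ring.
Qed.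

Lemma rect_int_swap_h f a b c d : (forall z, in_rect a b c d z -> ccont f z) ->
  rect_int f b a c d = (- rect_int f a b c d)%C.
Proof.
  intros Hf. unfold rect_int.
  assert (Hab := Rmin_Rmax_bounds a b). assert (Hcd := Rmin_Rmax_bounds c d).
  rewrite !(CInt_swap _ a b) by (eapply ex_CInt_h; eauto; tauto). ring.
Qed.

Lemma rect_int_swap_v f a b c d : (forall z, in_rect a b c d z -> ccont f z) ->
  rect_int f a b d c = (- rect_int f a b c d)%C.
Proof.
  intros Hf. unfold rect_int.
  assert (Hab := Rmin_Rmax_bounds a b). assert (Hcd := Rmin_Rmax_bounds c d).
  rewrite !(CInt_swap _ c d) by (eapply ex_CInt_v; eauto; tauto). ring.
Qed.

(** Direct computation with explicit antiderivatives; this is the case of Cauchy's theorem from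
    which [goursat] derives the general one. *)
Lemma rect_int_affine (u v : C) a b c d : rect_int (fun z => u + v * z)%C a b c d = 0.
Proof.
  unfold rect_int.
  assert (H : forall y, CInt (fun s => u + v * (s, y))%C a b =
     ((u + v * (Ci * y)) * RtoC (b - a) + v * RtoC ((b ^ 2 - a ^ 2) / 2))%C).
  { intros y. rewrite <- (proj2 (CInt_affine _ _ _ _)). unfold CInt; f_equal;
    apply RInt_ext; intros x _; simpl; ring. }
  assert (H' : forall x, CInt (fun s => u + v * (x, s))%C c d =
     ((u + v * x) * RtoC (d - c) + v * Ci * RtoC ((d ^ 2 - c ^ 2) / 2))%C).
  { intros x. rewrite <- (proj2 (CInt_affine _ _ _ _)). unfold CInt; f_equal;
    apply RInt_ext; intros y _; simpl; ring. }
  rewrite !H, !H'. apply injective_projections; simpl; field.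
Qed.

Lemma ccont_affine (u v z : C) : ccont (fun z => u + v * z)%C z.
Proof.
  apply (cderiv_ccont _ _ v). intros eps He. exists 1; split; [lra|]. intros w _.
  replace (u + v * w - (u + v * z) - v * (w - z))%C with (RtoC 0) by ring.
  rewrite Cmod_0. apply Rmult_le_pos; [lra | apply Cmod_ge_0].
Qed.

Lemma ccont_minus f g z : ccont f z -> ccont g z -> ccont (fun z => f z - g z)%C z.
Proof.
  intros Hf Hg eps He.
  destruct (Hf (eps / 2)) as [d1 [Hd1 H1]]; [lra|].
  destruct (Hg (eps / 2)) as [d2 [Hd2 H2]]; [lra|].
  exists (Rmin d1 d2). split; [now apply Rmin_glb_lt|]. intros w Hw.
  specialize (H1 w (Rlt_le_trans _ _ _ Hw (Rmin_l _ _))).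
  specialize (H2 w (Rlt_le_trans _ _ _ Hw (Rmin_r _ _))).
  replace (f w - g w - (f z - g z))%C with ((f w - f z) + - (g w - g z))%C by ring.
  eapply Rle_lt_trans; [apply Cmod_triangle|]. rewrite Cmod_opp. lra.
Qed.

Lemma rect_int_minus f g a b c d : (forall z, in_rect a b c d z -> ccont f z) ->
  (forall z, in_rect a b c d z -> ccont g z) ->
  rect_int (fun z => f z - g z)%C a b c d = (rect_int f a b c d - rect_int g a b c d)%C.
Proof.
  intros Hf Hg. unfold rect_int.
  assert (Hab := Rmin_Rmax_bounds a b). assert (Hcd := Rmin_Rmax_bounds c d).
  rewrite (CInt_minus (fun s => f (s, c)) (fun s => g (s, c)))
    by (eapply ex_CInt_h; eauto; tauto).
  rewrite (CInt_minus (fun s => f (s, d)) (fun s => g (s, d)))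
    by (eapply ex_CInt_h; eauto; tauto).
  rewrite (CInt_minus (fun s => f (a, s)) (fun s => g (a, s)))
    by (eapply ex_CInt_v; eauto; tauto).
  rewrite (CInt_minus (fun s => f (b, s)) (fun s => g (b, s)))
    by (eapply ex_CInt_v; eauto; tauto).
  ring.
Qed.

(** Each side contributes at most 2 M times its length, and opposite sides come in pairs, hence the
    4. *)
Lemma Cmod_rect_int_le f a b c d M : a <= b -> c <= d ->
  (forall z, in_rect a b c d z -> ccont f z) ->
  (forall z, in_rect a b c d z -> Cmod (f z) <= M) ->
  Cmod (rect_int f a b c d) <= 4 * M * ((b - a) + (d - c)).
Proof.
  intros Hab Hcd Hf HM.
  assert (Bab := Rmin_Rmax_bounds a b). assert (Bcd := Rmin_Rmax_bounds c d).
  assert (Hh : forall y, Rmin c d <= y <= Rmax c d ->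
    Cmod (CInt (fun s => f (s, y)) a b) <= 2 * M * (b - a)).
  { intros y Hy. rewrite <- (Rabs_pos_eq (b - a)) by lra. apply Cmod_CInt_le.
    - eapply ex_CInt_h; eauto; tauto.
    - intros t Ht. apply HM. now split. }
  assert (Hv : forall x, Rmin a b <= x <= Rmax a b ->
    Cmod (CInt (fun s => f (x, s)) c d) <= 2 * M * (d - c)).
  { intros x Hx. rewrite <- (Rabs_pos_eq (d - c)) by lra. apply Cmod_CInt_le.
    - eapply ex_CInt_v; eauto; tauto.
    - intros t Ht. apply HM. now split. }
  unfold rect_int, Cminus.
  assert (T := fun x y => Cmod_triangle x y).
  eapply Rle_trans; [apply T|]. rewrite Cmod_opp, Cmod_mult, Cmod_Ci.
  eapply Rle_trans; [apply Rplus_le_compat_r, T|]. rewrite Cmod_opp.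
  eapply Rle_trans; [apply Rplus_le_compat_r, Rplus_le_compat_r, T|].
  rewrite Cmod_mult, Cmod_Ci.
  assert (h1 := Hh c (proj1 Bcd)). assert (h2 := Hh d (proj2 Bcd)).
  assert (h3 := Hv a (proj1 Bab)). assert (h4 := Hv b (proj2 Bab)). lra.
Qed.

(** * Goursat's theorem and primitives *)

Lemma nested_intervals (x s : nat -> R) : (forall n, 0 <= s n) ->
  (forall n, x n <= x (S n)) -> (forall n, x (S n) + s (S n) <= x n + s n) ->
  exists u, forall n, x n <= u <= x n + s n.
Proof.
  intros Hs Hx Hxs.
  assert (Hmono : forall n k, x n <= x (n + k)%nat).
  { intros n k. induction k as [|k IH]; [rewrite Nat.add_0_r; lra|].
    rewrite Nat.add_succ_r. specialize (Hx (n + k)%nat). lra. }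
  assert (Hdec : forall n k, x (n + k)%nat + s (n + k)%nat <= x n + s n).
  { intros n k. induction k as [|k IH]; [rewrite Nat.add_0_r; lra|].
    rewrite Nat.add_succ_r. specialize (Hxs (n + k)%nat). lra. }
  assert (Hub : forall n m, x m <= x n + s n).
  { intros n m. destruct (Nat.le_ge_cases m n) as [H|H].
    - replace n with (m + (n - m))%nat by lia.
      specialize (Hmono m (n - m)%nat). specialize (Hs (m + (n - m))%nat). lra.
    - replace m with (n + (m - n))%nat by lia.
      specialize (Hdec n (m - n)%nat). specialize (Hs (n + (m - n))%nat). lra. }
  destruct (completeness (fun r => exists n, r = x n)) as [u [Hu1 Hu2]].
  - exists (x 0%nat + s 0%nat). intros r [n ->]. apply Hub.
  - now exists (x 0%nat), 0%nat.
  - exists u. intros n. split; [apply Hu1; eauto|].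
    apply Hu2. intros r [m ->]. apply Hub.
Qed.

Lemma pow_half_small (s d : R) : 0 <= s -> 0 < d -> exists n, s * (/ 2) ^ n < d.
Proof.
  intros Hs Hd. destruct (pow_lt_1_zero (/ 2)) with (y := d / (s + 1)) as [n Hn].
  - rewrite Rabs_pos_eq; lra.
  - apply Rdiv_lt_0_compat; lra.
  - exists n. specialize (Hn n (Nat.le_refl n)).
    assert (Hp : 0 < (/ 2) ^ n) by (apply pow_lt; lra).
    rewrite Rabs_pos_eq in Hn by lra.
    apply (Rmult_lt_compat_l (s + 1)) in Hn; [|lra].
    replace ((s + 1) * (d / (s + 1))) with d in Hn by (field; lra). nra.
Qed.

(** Compactness in the form of bisection: a counterexample would have a bad quarter, that one again,
    and so on, and the nested bad rectangles shrink to a point (u, v) where the local hypothesis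
    forbids them. It serves both Goursat's theorem and the existence of maxima. *)
Lemma rect_bisection (P : R -> R -> R -> R -> Prop) :
  (forall x y s t, 0 <= s -> 0 <= t ->
    P x y (s / 2) (t / 2) -> P (x + s / 2) y (s / 2) (t / 2) ->
    P x (y + t / 2) (s / 2) (t / 2) -> P (x + s / 2) (y + t / 2) (s / 2) (t / 2) ->
    P x y s t) ->
  (forall u v, exists d, 0 < d /\ forall x y s t, 0 <= s < d -> 0 <= t < d ->
    x <= u <= x + s -> y <= v <= y + t -> P x y s t) ->
  forall x y s t, 0 <= s -> 0 <= t -> P x y s t.
Proof.
  intros Hsub Hloc x0 y0 s t Hs Ht. apply NNPP; intros Hn.
  set (sn := fun n => s * (/ 2) ^ n). set (tn := fun n => t * (/ 2) ^ n).
  assert (Hhalf : forall n, 0 <= (/ 2) ^ n) by (intros n; apply pow_le; lra).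
  assert (Hsn : forall n, 0 <= sn n) by (intros n; apply Rmult_le_pos; auto).
  assert (Htn : forall n, 0 <= tn n) by (intros n; apply Rmult_le_pos; auto).
  assert (HsS : forall n, sn (S n) = sn n / 2) by (intros n; unfold sn; simpl; field).
  assert (HtS : forall n, tn (S n) = tn n / 2) by (intros n; unfold tn; simpl; field).
  (* The hypothesis on p sits inside the existential so that choice yields a total function [next];
     where P holds, the value (0, 0) is arbitrary. *)
  assert (Hstep : forall n (p : R * R), exists q : R * R,
    ~ P (fst p) (snd p) (sn n) (tn n) ->
    ~ P (fst q) (snd q) (sn (S n)) (tn (S n)) /\
    fst p <= fst q <= fst p + sn (S n) /\ snd p <= snd q <= snd p + tn (S n)).
  { intros n [x y]. cbn [fst snd].
    destruct (classic (P x y (sn n) (tn n))) as [HP|HP]; [exists (0, 0); tauto|].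
    assert (H : exists q : R * R, ~ P (fst q) (snd q) (sn (S n)) (tn (S n)) /\
      x <= fst q <= x + sn (S n) /\ y <= snd q <= y + tn (S n)).
    { apply NNPP; intros HN. apply HP.
      assert (HQ : forall x' y', x <= x' <= x + sn (S n) -> y <= y' <= y + tn (S n) ->
        P x' y' (sn n / 2) (tn n / 2)).
      { intros x' y' Hx' Hy'. apply NNPP; intros HP'. apply HN. exists (x', y').
        rewrite HsS, HtS in *. simpl. tauto. }
      assert (h1 := Hsn n). assert (h2 := Htn n). rewrite HsS, HtS in HQ.
      apply Hsub; auto; apply HQ; lra. }
    destruct H as [q Hq]. exists q. tauto. }
  set (next := fun n p => proj1_sig (constructive_indefinite_description _ (Hstep n p))).
  set (pn := fix pn n := match n with O => (x0, y0) | S k => next k (pn k) end).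
  assert (Hpn : forall n, ~ P (fst (pn n)) (snd (pn n)) (sn n) (tn n)).
  { induction n as [|n IH].
    - unfold sn, tn; simpl. now rewrite !Rmult_1_r.
    - exact (proj1 (proj2_sig (constructive_indefinite_description _ (Hstep n (pn n))) IH)). }
  assert (Hnext : forall n, fst (pn n) <= fst (pn (S n)) <= fst (pn n) + sn (S n) /\
     snd (pn n) <= snd (pn (S n)) <= snd (pn n) + tn (S n)).
  { intros n. exact (proj2 (proj2_sig
      (constructive_indefinite_description _ (Hstep n (pn n))) (Hpn n))). }
  destruct (nested_intervals (fun n => fst (pn n)) sn) as [u Hu]; auto.
  { intros n. apply Hnext. }
  { intros n. destruct (Hnext n) as [H _]. rewrite HsS in *. lra. }
  destruct (nested_intervals (fun n => snd (pn n)) tn) as [v Hv]; auto.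
  { intros n. apply Hnext. }
  { intros n. destruct (Hnext n) as [_ H]. rewrite HtS in *. lra. }
  destruct (Hloc u v) as [d [Hd HP]].
  destruct (pow_half_small (s + t) d) as [n Hnd]; [lra | auto |].
  apply (Hpn n), HP; auto.
  - split; [apply Hsn|]. assert (h := Htn n). unfold sn, tn in *. lra.
  - split; [apply Htn|]. assert (h := Hsn n). unfold sn, tn in *. lra.
Qed.

(** The bound eps (s + t)^2 on the contour integral is inherited from the quarters because 4 (x /
    2)^2 = x^2. On small rectangles it holds because subtracting the affine approximation of f does
    not change the integral and leaves an integrand of size eps (s + t) / 4. *)
Lemma goursat f a b c d : a <= b -> c <= d ->
  (forall z, in_rect a b c d z -> exists l, cderiv f z l) -> rect_int f a b c d = 0.
Proof.
  intros Hab Hcd Hf.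
  assert (Hcont : forall z, in_rect a b c d z -> ccont f z).
  { intros z Hz. destruct (Hf z Hz) as [l Hl]. eapply cderiv_ccont; eauto. }
  assert (Hrect : forall x y s t z, a <= x -> x + s <= b -> c <= y -> y + t <= d ->
    0 <= s -> 0 <= t -> in_rect x (x + s) y (y + t) z -> in_rect a b c d z).
  { intros x y s t z; unfold in_rect; intros.
    rewrite !Rmin_left, !Rmax_right in * by lra. lra. }
  assert (Hbound : forall eps, 0 < eps ->
    Cmod (rect_int f a b c d) <= eps * ((b - a) + (d - c)) ^ 2).
  { intros eps Heps.
    replace (rect_int f a b c d) with (rect_int f a (a + (b - a)) c (c + (d - c)))
      by (f_equal; ring).
    assert (HP : forall x y s t, 0 <= s -> 0 <= t -> a <= x -> x + s <= b -> c <= y ->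
      y + t <= d -> Cmod (rect_int f x (x + s) y (y + t)) <= eps * (s + t) ^ 2).
    2:{ apply HP; lra. }
    apply (rect_bisection (fun x y s t => a <= x -> x + s <= b -> c <= y -> y + t <= d ->
      Cmod (rect_int f x (x + s) y (y + t)) <= eps * (s + t) ^ 2)).
    - intros x y s t Hs Ht H1 H2 H3 H4 Hx Hxs Hy Hyt.
      rewrite (rect_int_split f _ _ _ _ (x + s / 2) (y + t / 2)); try lra.
      2:{ intros z Hz. apply Hcont. eapply (Hrect x y s t); eauto. }
      replace (x + s / 2 + s / 2) with (x + s) in * by field.
      replace (y + t / 2 + t / 2) with (y + t) in * by field.
      eapply Rle_trans; [apply Cmod_triangle|].
      eapply Rle_trans; [apply Rplus_le_compat; apply Cmod_triangle|].
      replace (eps * (s + t) ^ 2) with (4 * (eps * (s / 2 + t / 2) ^ 2)) by field.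
      assert (h1 := H1 ltac:(lra) ltac:(lra) ltac:(lra) ltac:(lra)).
      assert (h2 := H2 ltac:(lra) ltac:(lra) ltac:(lra) ltac:(lra)).
      assert (h3 := H3 ltac:(lra) ltac:(lra) ltac:(lra) ltac:(lra)).
      assert (h4 := H4 ltac:(lra) ltac:(lra) ltac:(lra) ltac:(lra)). lra.
    - intros u v.
      destruct (classic (in_rect a b c d (u, v))) as [Huv|Huv].
      2:{ exists 1; split; [lra|]. intros x y s t Hs Ht Hu Hv Hx Hxs Hy Hyt.
          exfalso. apply Huv. unfold in_rect; simpl.
          rewrite !Rmin_left, !Rmax_right by lra. lra. }
      (* The 1 / 4 cancels the constant of [Cmod_rect_int_le]; below, [dl / 2] is taken because
         points of the rectangle are within s + t of (u, v). *)
      destruct (Hf _ Huv) as [l Hl]. destruct (Hl (eps / 4)) as [dl [Hdl Hl']]; [lra|].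
      exists (dl / 2). split; [lra|]. intros x y s t Hs Ht Hu Hv Hx Hxs Hy Hyt.
      set (z0 := (u, v) : C).
      set (aff := fun z : C => ((f z0 - l * z0) + l * z)%C).
      assert (Hd : forall z, in_rect x (x + s) y (y + t) z -> Cmod (z - z0) <= s + t).
      { intros z [Hz1 Hz2]. rewrite !Rmin_left, !Rmax_right in * by lra.
        eapply Rle_trans; [apply Cmod_sub_bounds|]. simpl.
        apply Rplus_le_compat; apply Rabs_le; lra. }
      replace (rect_int f x (x + s) y (y + t)) with
        (rect_int (fun z => f z - aff z)%C x (x + s) y (y + t)).
      2:{ rewrite rect_int_minus.
          - unfold aff at 1. rewrite rect_int_affine. ring.
          - intros z Hz. apply Hcont. eapply (Hrect x y s t); eauto; lra.
          - intros z _. apply ccont_affine. }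
      eapply Rle_trans;
        [apply (Cmod_rect_int_le _ _ _ _ _ (eps / 4 * (s + t))); try lra|].
      + intros z Hz. apply ccont_minus; [|apply ccont_affine].
        apply Hcont. eapply (Hrect x y s t); eauto; lra.
      + intros z Hz. specialize (Hd z Hz). unfold aff.
        replace (f z - (f z0 - l * z0 + l * z))%C with (f z - f z0 - l * (z - z0))%C by ring.
        eapply Rle_trans; [apply Hl'; fold z0; lra|]. fold z0.
        apply Rmult_le_compat_l; lra.
      + right. field. }
  apply Cmod_eq_0. apply Rle_antisym; [|apply Cmod_ge_0].
  apply Rnot_lt_le; intros Hpos. set (A := ((b - a) + (d - c)) ^ 2) in *.
  assert (HA : 0 <= A) by apply pow2_ge_0.
  specialize (Hbound (Cmod (rect_int f a b c d) / (2 * (A + 1)))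
    ltac:(apply Rdiv_lt_0_compat; lra)).
  set (X := Cmod (rect_int f a b c d)) in *.
  assert (X / (2 * (A + 1)) * A <= X / (2 * (A + 1)) * (A + 1)).
  { apply Rmult_le_compat_l; [|lra]. left; apply Rdiv_lt_0_compat; lra. }
  replace (X / (2 * (A + 1)) * (A + 1)) with (X / 2) in * by (field; lra). lra.
Qed.

Lemma goursat_oriented f a b c d :
  (forall z, in_rect a b c d z -> exists l, cderiv f z l) -> rect_int f a b c d = 0.
Proof.
  intros Hf.
  assert (Sh : forall a b c d z, in_rect b a c d z -> in_rect a b c d z).
  { intros a' b' c' d' z. unfold in_rect. now rewrite (Rmin_comm b'), (Rmax_comm b'). }
  assert (Sv : forall a b c d z, in_rect a b d c z -> in_rect a b c d z).
  { intros a' b' c' d' z. unfold in_rect. now rewrite (Rmin_comm d'), (Rmax_comm d'). }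
  assert (Hc : forall a b c d, (forall z, in_rect a b c d z -> exists l, cderiv f z l) ->
    forall z, in_rect a b c d z -> ccont f z).
  { intros a' b' c' d' H z Hz. destruct (H z Hz) as [l Hl]. eapply cderiv_ccont; eauto. }
  assert (Hv : forall a b, a <= b -> (forall z, in_rect a b c d z -> exists l, cderiv f z l) ->
    rect_int f a b c d = 0).
  { intros a' b' Hab H. destruct (Rle_dec c d) as [Hcd|Hcd]; [now apply goursat|].
    rewrite rect_int_swap_v by (apply Hc; auto).
    rewrite goursat; try lra; auto. ring. }
  destruct (Rle_dec a b) as [Hab|Hab]; [now apply Hv|].
  rewrite rect_int_swap_h by (apply Hc; auto).
  rewrite Hv; try lra; auto. ring.
Qed.

(** Squares replace discs because the rectangle spanned by two of their points lies inside, so paths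
    made of horizontal and vertical pieces stay in the domain. *)
Definition in_square (q : C) (r : R) (z : C) : Prop :=
  Rabs (fst z - fst q) < r /\ Rabs (snd z - snd q) < r.

Lemma in_square_corner q r z w : in_square q r z -> in_square q r w ->
  in_square q r (fst z, snd w).
Proof. intros [H1 H2] [H3 H4]. split; simpl; auto. Qed.

Lemma in_square_rect q r z w u : in_square q r z -> in_square q r w ->
  in_rect (fst z) (fst w) (snd z) (snd w) u -> in_square q r u.
Proof.
  intros [H1 H2] [H3 H4] [H5 H6]. apply Rabs_def2 in H1, H2, H3, H4.
  split; apply Rabs_def1;
    revert H5 H6; unfold Rmin, Rmax; destruct (Rle_dec (fst z) (fst w));
    destruct (Rle_dec (snd z) (snd w)); lra.
Qed.

Lemma in_square_center q r : 0 < r -> in_square q r q.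
Proof. intros H; split; rewrite Rminus_diag, Rabs_R0; auto. Qed.

Lemma in_square_open q r z : in_square q r z ->
  exists d, 0 < d /\ forall w, Cmod (w - z) < d -> in_square q r w.
Proof.
  intros [H1 H2].
  exists (Rmin (r - Rabs (fst z - fst q)) (r - Rabs (snd z - snd q))).
  split; [apply Rmin_glb_lt; lra|]. intros w Hw.
  assert (Hw1 := Rlt_le_trans _ _ _ Hw (Rmin_l _ _)).
  assert (Hw2 := Rlt_le_trans _ _ _ Hw (Rmin_r _ _)).
  destruct (Cmod_sub_bounds w z) as [B1 [B2 _]].
  split.
  - replace (fst w - fst q) with ((fst w - fst z) + (fst z - fst q)) by ring.
    eapply Rle_lt_trans; [apply Rabs_triang|]. lra.
  - replace (snd w - snd q) with ((snd w - snd z) + (snd z - snd q)) by ring.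
    eapply Rle_lt_trans; [apply Rabs_triang|]. lra.
Qed.

(** The integral of f along the L-shaped path from q to z, horizontal first. *)
Definition prim (f : C -> C) (q z : C) : C :=
  (CInt (fun s => f (s, snd q)) (fst q) (fst z)
   + Ci * CInt (fun t => f (fst z, t)) (snd q) (snd z))%C.

Lemma ex_CInt_square_h f q r y a b : (forall z, in_square q r z -> ccont f z) ->
  in_square q r (a, y) -> in_square q r (b, y) -> ex_CInt (fun s => f (s, y)) a b.
Proof.
  intros Hf Ha Hb. apply (ex_CInt_h f a b y y).
  - intros z Hz. apply Hf. eapply (in_square_rect q r (a, y) (b, y)); eauto.
  - rewrite Rmin_left, Rmax_left; lra.
  - apply Rmin_Rmax_bounds.
  - apply Rmin_Rmax_bounds.
Qed.

Lemma ex_CInt_square_v f q r x c d : (forall z, in_square q r z -> ccont f z) ->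
  in_square q r (x, c) -> in_square q r (x, d) -> ex_CInt (fun t => f (x, t)) c d.
Proof.
  intros Hf Ha Hb. apply (ex_CInt_v f x x c d).
  - intros z Hz. apply Hf. eapply (in_square_rect q r (x, c) (x, d)); eauto.
  - rewrite Rmin_left, Rmax_left; lra.
  - apply Rmin_Rmax_bounds.
  - apply Rmin_Rmax_bounds.
Qed.

(** The L-shaped path to w and the one through z differ by the boundary of the rectangle with
    opposite corners (Re z, Im q) and (Re w, Im z), over which the integral vanishes by Goursat. *)
Lemma prim_diff f q r z w : 0 < r ->
  (forall z, in_square q r z -> exists l, cderiv f z l) ->
  in_square q r z -> in_square q r w ->
  (prim f q w - prim f q z =
   CInt (fun s => f (s, snd z)) (fst z) (fst w)
   + Ci * CInt (fun t => f (fst w, t)) (snd z) (snd w))%C.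
Proof.
  intros Hr Hf Hz Hw. assert (Hq := in_square_center q r Hr).
  assert (Hc : forall z, in_square q r z -> ccont f z).
  { intros u Hu. destruct (Hf u Hu) as [l Hl]. eapply cderiv_ccont; eauto. }
  assert (G : rect_int f (fst z) (fst w) (snd q) (snd z) = 0).
  { apply goursat_oriented. intros u Hu. apply Hf.
    eapply (in_square_rect q r (fst z, snd q) (fst w, snd z)); eauto;
      apply in_square_corner; auto. }
  unfold rect_int in G. unfold prim.
  rewrite (CInt_Chasles (fun s => f (s, snd q)) (fst q) (fst z) (fst w)).
  2,3: eapply ex_CInt_square_h; eauto; apply in_square_corner; auto.
  rewrite (CInt_Chasles (fun t => f (fst w, t)) (snd q) (snd z) (snd w)).
  2,3: eapply ex_CInt_square_v; eauto; apply in_square_corner; auto.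
  match type of G with ?L = _ =>
  match goal with |- _ = ?Rr => transitivity (Rr + L)%C; [ring | rewrite G; ring] end end.
Qed.

Lemma prim_cderiv f q r z : 0 < r ->
  (forall z, in_square q r z -> exists l, cderiv f z l) ->
  in_square q r z -> cderiv (prim f q) z (f z).
Proof.
  intros Hr Hf Hz eps He.
  assert (Hc : forall z, in_square q r z -> ccont f z).
  { intros u Hu. destruct (Hf u Hu) as [l Hl]. eapply cderiv_ccont; eauto. }
  destruct (Hc z Hz (eps / 4)) as [d1 [Hd1 H1]]; [lra|].
  destruct (in_square_open q r z Hz) as [d2 [Hd2 H2]].
  (* Points u of the rectangle spanned by z and w satisfy |u - z| <= 2 |w - z|, hence [d1 / 2]. The
     tolerance eps / 4 absorbs the factor 2 of [Cmod_CInt_le] and the sum of two coordinate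
     increments. *)
  exists (Rmin (d1 / 2) d2). split; [apply Rmin_glb_lt; lra|]. intros w Hw.
  assert (Hw1 := Rlt_le_trans _ _ _ Hw (Rmin_l _ _)).
  assert (Hw2 := H2 w (Rlt_le_trans _ _ _ Hw (Rmin_r _ _))).
  destruct (Cmod_sub_bounds w z) as [B1 [B2 _]].
  rewrite (prim_diff f q r) by auto.
  assert (Eh : ex_CInt (fun s => f (s, snd z)) (fst z) (fst w))
    by (eapply ex_CInt_square_h; eauto; apply in_square_corner; auto).
  assert (Ev : ex_CInt (fun t => f (fst w, t)) (snd z) (snd w))
    by (eapply ex_CInt_square_v; eauto; apply in_square_corner; auto).
  destruct (CInt_affine (f z) 0 (fst z) (fst w)) as [Ch Ch'].
  destruct (CInt_affine (f z) 0 (snd z) (snd w)) as [Cv Cv'].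
  assert (Hnear : forall u, in_rect (fst z) (fst w) (snd z) (snd w) u ->
    Cmod (f u - (f z + 0 * u)) <= eps / 4).
  { intros u [Hu1 Hu2]. replace (f u - (f z + 0 * u))%C with (f u - f z)%C by ring.
    left. apply H1. eapply Rle_lt_trans; [apply Cmod_sub_bounds|].
    assert (Rabs (fst u - fst z) <= Rabs (fst w - fst z)).
    { revert Hu1. unfold Rmin, Rmax, Rabs.
      destruct (Rle_dec (fst z) (fst w)), (Rcase_abs (fst u - fst z)),
        (Rcase_abs (fst w - fst z)); lra. }
    assert (Rabs (snd u - snd z) <= Rabs (snd w - snd z)).
    { revert Hu2. unfold Rmin, Rmax, Rabs.
      destruct (Rle_dec (snd z) (snd w)), (Rcase_abs (snd u - snd z)),
        (Rcase_abs (snd w - snd z)); lra. }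
    lra. }
  assert (Gh : Cmod (CInt (fun s => f (s, snd z) - (f z + 0 * RtoC s))%C (fst z) (fst w))
    <= 2 * (eps / 4) * Rabs (fst w - fst z)).
  { apply Cmod_CInt_le; [now apply ex_CInt_minus|]. intros t Ht.
    replace (f (t, snd z) - (f z + 0 * RtoC t))%C with
      (f (t, snd z) - (f z + 0 * (t, snd z)))%C by ring.
    apply Hnear. split; simpl; auto. apply Rmin_Rmax_bounds. }
  assert (Gv : Cmod (CInt (fun t => f (fst w, t) - (f z + 0 * RtoC t))%C (snd z) (snd w))
    <= 2 * (eps / 4) * Rabs (snd w - snd z)).
  { apply Cmod_CInt_le; [now apply ex_CInt_minus|]. intros t Ht.
    replace (f (fst w, t) - (f z + 0 * RtoC t))%C with
      (f (fst w, t) - (f z + 0 * (fst w, t)))%C by ring.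
    apply Hnear. split; simpl; auto. apply Rmin_Rmax_bounds. }
  rewrite CInt_minus in Gh, Gv by auto. rewrite Ch' in Gh. rewrite Cv' in Gv.
  match goal with |- Cmod ?X <= _ =>
    match type of Gh with Cmod ?A <= _ => match type of Gv with Cmod ?B <= _ =>
      replace X with (A + Ci * B)%C end end end.
  2:{ replace (w - z)%C with (RtoC (fst w - fst z) + Ci * RtoC (snd w - snd z))%C
        by (apply injective_projections; simpl; ring). ring. }
  eapply Rle_trans; [apply Cmod_triangle|]. rewrite Cmod_mult, Cmod_Ci. nra.
Qed.

Lemma prim_zero (f : C -> C) q e z : (forall z, in_square q e z -> f z = 0) ->
  in_square q e z -> prim f q z = 0.
Proof.
  intros Hf Hz.
  assert (Hq : in_square q e q)
    by (apply in_square_center; eapply Rle_lt_trans; [apply Rabs_pos | apply Hz]).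
  assert (E : forall (g : R -> C) a b, (forall s, Rmin a b <= s <= Rmax a b -> g s = 0) ->
    CInt g a b = 0).
  { intros g a b Hg. unfold CInt. apply injective_projections; simpl;
      (transitivity (RInt (V := R_CompleteNormedModule) (fun _ => 0) a b);
       [ apply RInt_ext; intros s Hs; rewrite Hg by lra; reflexivity
       | rewrite RInt_const; unfold scal; simpl; unfold mult; simpl; ring ]). }
  unfold prim. rewrite !E; [ring | |]; intros s Hs; apply Hf.
  - apply (in_square_rect q e (fst z, snd q) (fst z, snd z)); auto;
      try (apply in_square_corner; auto).
    split; simpl; auto. rewrite Rmin_left, Rmax_left; lra.
  - apply (in_square_rect q e q (fst z, snd q)); auto;
      try (apply in_square_corner; auto).
    split; simpl; auto. rewrite Rmin_left, Rmax_left; lra.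
Qed.

(** * The maximum principle *)

Definition rderiv (f : R -> R) (x l : R) : Prop :=
  forall eps, 0 < eps -> exists d, 0 < d /\ forall y, Rabs (y - x) < d ->
    Rabs (f y - f x - l * (y - x)) <= eps * Rabs (y - x).

Lemma rderiv_is_derive f x l : rderiv f x l -> is_derive f x l.
Proof.
  intros H. split; [apply is_linear_scal_l|].
  intros x' Hx' eps. rewrite <- (is_filter_lim_locally_unique _ _ Hx').
  destruct (H eps (cond_pos eps)) as [d [Hd Hd']].
  exists (mkposreal d Hd). intros y Hy. specialize (Hd' y Hy).
  rewrite Rmult_comm in Hd'. exact Hd'.
Qed.

(** If d > 0, then [phi1] is positive just to the right of x0 when [phi1 x0 >= 0], and negative just
    to the left otherwise. Either way the mean value theorem gives a value above [phi x0], without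
    first showing [phi1 x0 = 0]. *)
Lemma second_derivative_test (phi phi1 : R -> R) x0 d eta : 0 < eta ->
  (forall x, Rabs (x - x0) < eta -> rderiv phi x (phi1 x)) -> rderiv phi1 x0 d ->
  (forall x, Rabs (x - x0) < eta -> phi x <= phi x0) -> d <= 0.
Proof.
  intros Heta Hphi Hphi1 Hmax. apply Rnot_lt_le; intros Hd.
  destruct (Hphi1 (d / 2)) as [e [He H]]; [lra|].
  set (h := Rmin e eta / 2).
  assert (Hh : 0 < h /\ h < e /\ h < eta).
  { assert (h1 := Rmin_l e eta). assert (h2 := Rmin_r e eta).
    assert (0 < Rmin e eta) by now apply Rmin_glb_lt. unfold h. lra. }
  assert (Hder : forall x, Rabs (x - x0) < eta -> derivable_pt_lim phi x (phi1 x)).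
  { intros x Hx. now apply is_derive_Reals, rderiv_is_derive, Hphi. }
  destruct (Rle_lt_dec 0 (phi1 x0)) as [Hp|Hp].
  - destruct (MVT_cor2 phi phi1 x0 (x0 + h)) as [xi [Hxi Hxi']]; [lra | |].
    + intros c Hc. apply Hder, Rabs_def1; lra.
    + assert (G := H xi ltac:(apply Rabs_def1; lra)).
      rewrite (Rabs_pos_eq (xi - x0)) in G by lra. apply Rabs_le_between in G.
      assert (G2 := Hmax (x0 + h) ltac:(apply Rabs_def1; lra)).
      assert (0 < phi1 xi) by nra. nra.
  - destruct (MVT_cor2 phi phi1 (x0 - h) x0) as [xi [Hxi Hxi']]; [lra | |].
    + intros c Hc. apply Hder, Rabs_def1; lra.
    + assert (G := H xi ltac:(apply Rabs_def1; lra)).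
      rewrite (Rabs_left (xi - x0)) in G by lra. apply Rabs_le_between in G.
      assert (G2 := Hmax (x0 - h) ltac:(apply Rabs_def1; lra)).
      assert (phi1 xi < 0) by nra. nra.
Qed.

Definition in_csquare (q : C) (r : R) (z : C) : Prop :=
  Rabs (fst z - fst q) <= r /\ Rabs (snd z - snd q) <= r.

(** Without a maximum, every point is beaten by some w, which by continuity also beats a
    neighbourhood. Being beaten by a single w passes from quarters to the whole, so bisection
    produces a w that beats the entire square, itself included. *)
Lemma csquare_max (phi : C -> R) q r : 0 <= r ->
  (forall z, in_csquare q r z -> forall eps, 0 < eps -> exists d, 0 < d /\
    forall w, in_csquare q r w -> Cmod (w - z) < d -> Rabs (phi w - phi z) < eps) ->
  exists z, in_csquare q r z /\ forall w, in_csquare q r w -> phi w <= phi z.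
Proof.
  intros Hr Hc. apply NNPP; intros Hno.
  assert (Hno' : forall z, in_csquare q r z -> exists w, in_csquare q r w /\ phi z < phi w).
  { intros z Hz. apply NNPP; intros HN. apply Hno. exists z; split; auto.
    intros w Hw. apply Rnot_lt_le. intros H. apply HN; eauto. }
  assert (Hq : in_csquare q r q) by (split; rewrite Rminus_diag, Rabs_R0; auto).
  assert (HP : forall x y s t, 0 <= s -> 0 <= t -> exists w, in_csquare q r w /\
    forall z, in_csquare q r z -> x <= fst z <= x + s -> y <= snd z <= y + t -> phi z < phi w).
  { apply rect_bisection.
    - intros x y s t Hs Ht [w1 [I1 H1]] [w2 [I2 H2]] [w3 [I3 H3]] [w4 [I4 H4]].
      assert (M : forall w w', in_csquare q r w -> in_csquare q r w' ->
        exists v, in_csquare q r v /\ phi w <= phi v /\ phi w' <= phi v).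
      { intros w w' Hw Hw'. destruct (Rle_dec (phi w) (phi w'));
          [exists w' | exists w]; repeat split; auto; try apply Hw; try apply Hw'; lra. }
      destruct (M w1 w2) as [w5 [I5 H5]]; auto. destruct (M w3 w4) as [w6 [I6 H6]]; auto.
      destruct (M w5 w6) as [w7 [I7 H7]]; auto. exists w7; split; auto.
      intros z Hz Hx Hy.
      destruct (Rle_dec (fst z) (x + s / 2)), (Rle_dec (snd z) (y + t / 2)).
      + specialize (H1 z Hz ltac:(lra) ltac:(lra)). lra.
      + specialize (H3 z Hz ltac:(lra) ltac:(lra)). lra.
      + specialize (H2 z Hz ltac:(lra) ltac:(lra)). lra.
      + specialize (H4 z Hz ltac:(lra) ltac:(lra)). lra.
    - intros u v. destruct (classic (in_csquare q r (u, v))) as [Huv|Huv].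
      + destruct (Hno' _ Huv) as [w [Hw Hlt]].
        destruct (Hc _ Huv (phi w - phi (u, v))) as [d [Hd H]]; [lra|].
        exists (d / 2); split; [lra|]. intros x y s t Hs Ht Hu Hv. exists w; split; auto.
        intros z Hz Hx Hy. specialize (H z Hz).
        assert (Hzd : Cmod (z - (u, v)) < d).
        { eapply Rle_lt_trans; [apply Cmod_sub_bounds|]. simpl.
          assert (Rabs (fst z - u) <= s) by (apply Rabs_le; lra).
          assert (Rabs (snd z - v) <= t) by (apply Rabs_le; lra). lra. }
        specialize (H Hzd). apply Rabs_def2 in H. lra.
      + assert (Hopen : exists d, 0 < d /\ forall z, Rabs (fst z - u) < d ->
          Rabs (snd z - v) < d -> ~ in_csquare q r z).
        { destruct (Rle_dec (Rabs (u - fst q)) r) as [H1|H1].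
          - destruct (Rle_dec (Rabs (v - snd q)) r) as [H2|H2].
            + exfalso; apply Huv; split; auto.
            + exists (Rabs (v - snd q) - r); split; [lra|]. intros z _ Hz [_ Hz'].
              assert (T := Rabs_triang (v - snd z) (snd z - snd q)).
              rewrite (Rabs_minus_sym v) in T.
              replace (v - snd z + (snd z - snd q)) with (v - snd q) in T by ring. lra.
          - exists (Rabs (u - fst q) - r); split; [lra|]. intros z Hz _ [Hz' _].
            assert (T := Rabs_triang (u - fst z) (fst z - fst q)).
            rewrite (Rabs_minus_sym u) in T.
            replace (u - fst z + (fst z - fst q)) with (u - fst q) in T by ring. lra. }
        destruct Hopen as [d [Hd H]]. exists d; split; auto.
        intros x y s t Hs Ht Hu Hv. exists q; split; auto. intros z Hz Hx Hy.
        exfalso. apply (H z); auto; apply Rabs_def1; lra. }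
  destruct (HP (fst q - r) (snd q - r) (2 * r) (2 * r)) as [w [Hw H]]; [lra | lra |].
  assert (Hw' := Hw). destruct Hw' as [W1 W2].
  apply Rabs_le_between in W1. apply Rabs_le_between in W2.
  specialize (H w Hw ltac:(lra) ltac:(lra)). lra.
Qed.

Lemma cderiv_fst_h K (l : C) x y : cderiv K (x, y) l ->
  rderiv (fun s => fst (K (s, y))) x (fst l).
Proof.
  intros H eps He. destruct (H eps He) as [d [Hd H1]]. exists d; split; auto.
  intros s Hs.
  assert (E : ((s, y) - (x, y))%C = RtoC (s - x))
    by (apply injective_projections; simpl; ring).
  specialize (H1 (s, y)). rewrite E, Cmod_R in H1. specialize (H1 Hs).
  eapply Rle_trans; [|exact H1]. eapply Rle_trans; [|apply fst_le_Cmod].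
  right. f_equal. simpl. ring.
Qed.

(** Cauchy-Riemann: a vertical increment is i times a real one, and Re (i l) = - Im l. Together with
    [cderiv_snd_v] this yields u_yy = - Re K'' for u = Re K. *)
Lemma cderiv_fst_v K (l : C) x y : cderiv K (x, y) l ->
  rderiv (fun t => fst (K (x, t))) y (- snd l).
Proof.
  intros H eps He. destruct (H eps He) as [d [Hd H1]]. exists d; split; auto.
  intros s Hs.
  assert (E : ((x, s) - (x, y))%C = (Ci * RtoC (s - y))%C)
    by (apply injective_projections; simpl; ring).
  specialize (H1 (x, s)). rewrite E, Cmod_mult, Cmod_Ci, Cmod_R, Rmult_1_l in H1.
  specialize (H1 Hs).
  eapply Rle_trans; [|exact H1]. eapply Rle_trans; [|apply fst_le_Cmod].
  right. f_equal. simpl. ring.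
Qed.

Lemma cderiv_snd_v K (l : C) x y : cderiv K (x, y) l ->
  rderiv (fun t => - snd (K (x, t))) y (- fst l).
Proof.
  intros H eps He. destruct (H eps He) as [d [Hd H1]]. exists d; split; auto.
  intros s Hs.
  assert (E : ((x, s) - (x, y))%C = (Ci * RtoC (s - y))%C)
    by (apply injective_projections; simpl; ring).
  specialize (H1 (x, s)). rewrite E, Cmod_mult, Cmod_Ci, Cmod_R, Rmult_1_l in H1.
  specialize (H1 Hs).
  eapply Rle_trans; [|exact H1]. eapply Rle_trans; [|apply snd_le_Cmod].
  rewrite <- Rabs_Ropp. right. f_equal. simpl. ring.
Qed.

Lemma rderiv_plus f g x l m : rderiv f x l -> rderiv g x m ->
  rderiv (fun x => f x + g x) x (l + m).
Proof.
  intros Hf Hg eps He.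
  destruct (Hf (eps / 2)) as [d1 [Hd1 H1]]; [lra|].
  destruct (Hg (eps / 2)) as [d2 [Hd2 H2]]; [lra|].
  exists (Rmin d1 d2). split; [now apply Rmin_glb_lt|]. intros y Hy.
  specialize (H1 y (Rlt_le_trans _ _ _ Hy (Rmin_l _ _))).
  specialize (H2 y (Rlt_le_trans _ _ _ Hy (Rmin_r _ _))).
  replace (f y + g y - (f x + g x) - (l + m) * (y - x)) with
    ((f y - f x - l * (y - x)) + (g y - g x - m * (y - x))) by ring.
  eapply Rle_trans; [apply Rabs_triang|]. lra.
Qed.

Lemma rderiv_quadratic (e c k x : R) :
  rderiv (fun x => e * (x - c) ^ 2 + k) x (2 * e * (x - c)).
Proof.
  intros eps He. exists (eps / (Rabs e + 1)).
  assert (Ha := Rabs_pos e). split; [apply Rdiv_lt_0_compat; lra|]. intros y Hy.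
  replace (e * (y - c) ^ 2 + k - (e * (x - c) ^ 2 + k) - 2 * e * (x - c) * (y - x)) with
    ((e * (y - x)) * (y - x)) by ring.
  rewrite Rabs_mult. apply Rmult_le_compat_r; [apply Rabs_pos|]. rewrite Rabs_mult.
  apply (Rmult_lt_compat_l (Rabs e + 1)) in Hy; [|lra].
  replace ((Rabs e + 1) * (eps / (Rabs e + 1))) with eps in Hy by (field; lra).
  assert (h := Rabs_pos (y - x)). lra.
Qed.

Lemma rderiv_linear (e c x : R) : rderiv (fun x => 2 * e * (x - c)) x (2 * e).
Proof.
  intros eps He. exists 1; split; [lra|]. intros y _.
  replace (2 * e * (y - c) - 2 * e * (x - c) - 2 * e * (y - x)) with 0 by ring.
  rewrite Rabs_R0. apply Rmult_le_pos; [lra | apply Rabs_pos].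
Qed.

(** Mere existence of the second derivative, without continuity, is what the second derivative test
    at a maximum needs. *)
Definition twice_cderiv (K K1 : C -> C) (q : C) (r : R) : Prop :=
  forall z, in_square q r z -> cderiv K z (K1 z) /\ exists l, cderiv K1 z l.

Definition on_square_boundary (q : C) (r : R) (z : C) : Prop :=
  in_csquare q r z /\ (Rabs (fst z - fst q) = r \/ Rabs (snd z - snd q) = r).

(* The real part u of K is harmonic, so u + e |z - q|^2 has Laplacian 4 e > 0 and
   therefore no interior maximum. *)
Lemma max_principle_Re K K1 q r r' B : 0 < r' < r -> twice_cderiv K K1 q r ->
  (forall z, on_square_boundary q r' z -> fst (K z) <= B) ->
  forall z, in_csquare q r' z -> fst (K z) <= B.
Proof.
  intros Hr HK HB z Hz. apply Rnot_lt_le; intros Hlt.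
  (* With this e the perturbation, at most 2 e r'^2 on the square, stays within half of the excess
     of Re K(z) over B. So [phi] on the boundary is below [phi z], and its maximum is interior. *)
  set (e := (fst (K z) - B) / (4 * r' ^ 2)).
  assert (Hr2 : 0 < r' ^ 2) by (apply pow_lt; lra).
  assert (He : 0 < e) by (apply Rdiv_lt_0_compat; lra).
  assert (He' : e * (2 * r' ^ 2) = (fst (K z) - B) / 2) by (unfold e; field; lra).
  set (phi := fun w : C => fst (K w) + (e * (fst w - fst q) ^ 2 + e * (snd w - snd q) ^ 2)).
  assert (Hin : forall w, in_csquare q r' w -> in_square q r w)
    by (intros w [H1 H2]; split; lra).
  destruct (csquare_max phi q r') as [m [Hm Hmax]]; [lra | |].
  - intros w Hw eps Heps.
    assert (HQ : ccont (fun w => (phi w, 0)) w).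
    { clear - HK Hin Hw.
      destruct (HK w (Hin w Hw)) as [HK1 _]. apply cderiv_ccont in HK1.
      intros eps Heps. destruct (HK1 (eps / 2)) as [d1 [Hd1 H1]]; [lra|].
      set (A := Rabs e * (2 * Rabs (fst w - fst q) + 2 * Rabs (snd w - snd q) + 2)).
      assert (HA : 0 <= A).
      { apply Rmult_le_pos; [apply Rabs_pos|].
        assert (h1 := Rabs_pos (fst w - fst q)). assert (h2 := Rabs_pos (snd w - snd q)). lra. }
      set (d3 := eps / (2 * (A + 1))).
      assert (Hd3 : 0 < d3) by (apply Rdiv_lt_0_compat; lra).
      exists (Rmin d1 (Rmin 1 d3)). split; [repeat apply Rmin_glb_lt; lra|].
      intros v Hv.
      assert (Hv1 := Rlt_le_trans _ _ _ Hv (Rmin_l _ _)).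
      assert (Hv2 := Rlt_le_trans _ _ _ Hv (Rmin_r _ _)).
      assert (Hv3 := Rlt_le_trans _ _ _ Hv2 (Rmin_l _ _)).
      assert (Hv4 := Rlt_le_trans _ _ _ Hv2 (Rmin_r _ _)).
      specialize (H1 v Hv1). destruct (Cmod_sub_bounds v w) as [B1 [B2 _]].
      eapply Rle_lt_trans; [apply Cmod_le_abs_add|]. simpl.
      replace (0 + - 0) with 0 by ring. rewrite Rabs_R0, Rplus_0_r.
      set (a := fst v - fst w) in *. set (b := snd v - snd w) in *.
      replace (phi v + - phi w) with ((fst (K v) - fst (K w))
        + e * (a * (2 * (fst w - fst q) + a) + b * (2 * (snd w - snd q) + b)))
        by (unfold phi, a, b; ring).
      eapply Rle_lt_trans; [apply Rabs_triang|].
      assert (G1 := proj1 (Cmod_sub_bounds (K v) (K w))).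
      assert (G2 : Rabs (e * (a * (2 * (fst w - fst q) + a) + b * (2 * (snd w - snd q) + b)))
        <= A * Cmod (v - w)).
      { rewrite Rabs_mult. unfold A. rewrite Rmult_assoc. apply Rmult_le_compat_l; [apply Rabs_pos|].
        eapply Rle_trans; [apply Rabs_triang|]. rewrite !Rabs_mult.
        assert (T1 := Rabs_triang (2 * (fst w - fst q)) a).
        assert (T2 := Rabs_triang (2 * (snd w - snd q)) b).
        rewrite Rabs_mult, (Rabs_pos_eq 2) in T1, T2 by lra.
        assert (P1 := Rabs_pos a). assert (P2 := Rabs_pos b).
        assert (P3 := Rabs_pos (2 * (fst w - fst q) + a)).
        assert (P4 := Rabs_pos (2 * (snd w - snd q) + b)).
        assert (Rabs a * Rabs (2 * (fst w - fst q) + a) <=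
          Cmod (v - w) * (2 * Rabs (fst w - fst q) + 1)) by (apply Rmult_le_compat; lra).
        assert (Rabs b * Rabs (2 * (snd w - snd q) + b) <=
          Cmod (v - w) * (2 * Rabs (snd w - snd q) + 1)) by (apply Rmult_le_compat; lra).
        lra. }
      assert (G3 : A * Cmod (v - w) <= eps / 2).
      { assert (P := Cmod_ge_0 (v - w)).
        apply (Rmult_lt_compat_l (A + 1)) in Hv4; [|lra].
        replace ((A + 1) * d3) with (eps / 2) in Hv4 by (unfold d3; field; lra). lra. }
      lra. }
    destruct (HQ eps Heps) as [d [Hd H]]. exists d; split; auto. intros v _ Hv.
    eapply Rle_lt_trans; [|apply (H v Hv)].
    apply (proj1 (Cmod_sub_bounds (phi v, 0) (phi w, 0))).
  - assert (Hquad : forall w, in_csquare q r' w -> fst (K w) <= phi w <= fst (K w) + e * (2 * r' ^ 2)).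
    { intros w [W1 W2]. unfold phi.
      assert (Q : forall x, Rabs x <= r' -> 0 <= e * x ^ 2 <= e * r' ^ 2).
      { intros x Hx. split.
        - apply Rmult_le_pos; [lra | apply pow2_ge_0].
        - apply Rmult_le_compat_l; [lra|]. rewrite <- (pow2_abs x).
          apply pow_incr. split; [apply Rabs_pos | auto]. }
      assert (Q1 := Q _ W1). assert (Q2 := Q _ W2). lra. }
    assert (Hint : Rabs (fst m - fst q) < r' /\ Rabs (snd m - snd q) < r').
    { apply NNPP; intros HN.
      assert (Hb : on_square_boundary q r' m).
      { split; auto. destruct Hm as [M1 M2].
        destruct (Req_dec (Rabs (fst m - fst q)) r'); [auto|].
        right. apply NNPP. intros ?. apply HN. split; lra. }
      specialize (HB m Hb). assert (G1 := Hmax z Hz).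
      assert (G2 := Hquad z Hz). assert (G3 := Hquad m Hm). lra. }
    set (eta := Rmin (r' - Rabs (fst m - fst q)) (r' - Rabs (snd m - snd q))).
    assert (Heta : 0 < eta) by (apply Rmin_glb_lt; lra).
    assert (Hh : forall x, Rabs (x - fst m) < eta -> in_csquare q r' (x, snd m)).
    { intros x Hx. split; simpl; [|lra].
      assert (h := Rlt_le_trans _ _ _ Hx (Rmin_l _ _)).
      replace (x - fst q) with ((x - fst m) + (fst m - fst q)) by ring.
      eapply Rle_trans; [apply Rabs_triang|]. lra. }
    assert (Hv : forall y, Rabs (y - snd m) < eta -> in_csquare q r' (fst m, y)).
    { intros y Hy. split; simpl; [lra|].
      assert (h := Rlt_le_trans _ _ _ Hy (Rmin_r _ _)).
      replace (y - snd q) with ((y - snd m) + (snd m - snd q)) by ring.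
      eapply Rle_trans; [apply Rabs_triang|]. lra. }
    assert (Em : m = (fst m, snd m)) by (now destruct m).
    destruct (proj2 (HK m (Hin m Hm))) as [k2 Dm]. rewrite Em in Dm.
    (* The horizontal and the vertical test give Re K'' + 2 e <= 0 and - Re K'' + 2 e <= 0; their
       sum contradicts e > 0. *)
    assert (Sx : fst k2 + 2 * e <= 0).
    { apply (second_derivative_test
        (fun x => fst (K (x, snd m)) + (e * (x - fst q) ^ 2 + e * (snd m - snd q) ^ 2))
        (fun x => fst (K1 (x, snd m)) + 2 * e * (x - fst q)) (fst m) _ eta Heta).
      - intros x Hx. destruct (HK _ (Hin _ (Hh x Hx))) as [D _].
        apply rderiv_plus; [now apply cderiv_fst_h | apply rderiv_quadratic].
      - apply rderiv_plus; [now apply cderiv_fst_h | apply rderiv_linear].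
      - intros x Hx. assert (G := Hmax _ (Hh x Hx)). rewrite Em in G.
        unfold phi in G. simpl in *. lra. }
    assert (Sy : - fst k2 + 2 * e <= 0).
    { apply (second_derivative_test
        (fun y => fst (K (fst m, y)) + (e * (y - snd q) ^ 2 + e * (fst m - fst q) ^ 2))
        (fun y => - snd (K1 (fst m, y)) + 2 * e * (y - snd q)) (snd m) _ eta Heta).
      - intros y Hy. destruct (HK _ (Hin _ (Hv y Hy))) as [D _].
        apply rderiv_plus; [now apply cderiv_fst_v | apply rderiv_quadratic].
      - apply rderiv_plus; [now apply cderiv_snd_v | apply rderiv_linear].
      - intros y Hy. assert (G := Hmax _ (Hv y Hy)). rewrite Em in G.
        unfold phi in G. simpl in *. lra. }
    lra.
Qed.

(** * Rules of complex differentiation, and the maximum principle for the modulus *)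

Lemma cderiv_mult f g z l m : cderiv f z l -> cderiv g z m ->
  cderiv (fun w => f w * g w)%C z (l * g z + f z * m)%C.
Proof.
  intros Hf Hg eps He.
  assert (Cg := cderiv_ccont _ _ _ Hg).
  set (a := Cmod (g z)). set (b := Cmod l). set (c := Cmod (f z)).
  assert (Ha : 0 <= a) by apply Cmod_ge_0. assert (Hb : 0 <= b) by apply Cmod_ge_0.
  assert (Hc : 0 <= c) by apply Cmod_ge_0.
  (* The three error terms are at most e (a + 1), b e and c e times |h|; e <= 1 ensures |g w| <= a +
     1 in the first. *)
  set (e := Rmin 1 (eps / (a + b + c + 1))).
  assert (He0 : 0 < e).
  { apply Rmin_glb_lt; [lra|]. apply Rdiv_lt_0_compat; lra. }
  assert (He1 : e * (a + b + c + 1) <= eps).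
  { assert (h := Rmin_r 1 (eps / (a + b + c + 1))). fold e in h.
    apply (Rmult_le_compat_r (a + b + c + 1)) in h; [|lra].
    replace (eps / (a + b + c + 1) * (a + b + c + 1)) with eps in h by (field; lra). lra. }
  assert (He2 : e <= 1) by apply Rmin_l.
  destruct (Hf e He0) as [d1 [Hd1 H1]]. destruct (Hg e He0) as [d2 [Hd2 H2]].
  destruct (Cg e He0) as [d3 [Hd3 H3]].
  exists (Rmin d1 (Rmin d2 d3)). split; [repeat apply Rmin_glb_lt; lra|]. intros w Hw.
  assert (Hw1 := Rlt_le_trans _ _ _ Hw (Rmin_l _ _)).
  assert (Hw' := Rlt_le_trans _ _ _ Hw (Rmin_r _ _)).
  assert (Hw2 := Rlt_le_trans _ _ _ Hw' (Rmin_l _ _)).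
  assert (Hw3 := Rlt_le_trans _ _ _ Hw' (Rmin_r _ _)).
  specialize (H1 w Hw1). specialize (H2 w Hw2). specialize (H3 w Hw3).
  set (h := (w - z)%C) in *. assert (Hh := Cmod_ge_0 h).
  replace (f w * g w - f z * g z - (l * g z + f z * m) * h)%C with
    ((f w - f z - l * h) * g w + l * h * (g w - g z) + f z * (g w - g z - m * h))%C by ring.
  assert (Hgw : Cmod (g w) <= a + e).
  { replace (g w) with (g z + (g w - g z))%C by ring.
    eapply Rle_trans; [apply Cmod_triangle|]. unfold a. lra. }
  eapply Rle_trans; [apply Cmod_triangle|].
  eapply Rle_trans; [apply Rplus_le_compat_r, Cmod_triangle|].
  rewrite !Cmod_mult. fold b c.
  assert (G1 : Cmod (f w - f z - l * h) * Cmod (g w) <= (e * Cmod h) * (a + 1))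
    by (apply Rmult_le_compat; try apply Cmod_ge_0; lra).
  assert (G2 : b * Cmod h * Cmod (g w - g z) <= b * Cmod h * e)
    by (apply Rmult_le_compat_l; [apply Rmult_le_pos|]; lra).
  assert (G3 : c * Cmod (g w - g z - m * h) <= c * (e * Cmod h))
    by (apply Rmult_le_compat_l; lra).
  assert (G4 : e * (a + b + c + 1) * Cmod h <= eps * Cmod h)
    by (apply Rmult_le_compat_r; lra).
  lra.
Qed.

Lemma cderiv_minus f g z l m : cderiv f z l -> cderiv g z m ->
  cderiv (fun w => f w - g w)%C z (l - m)%C.
Proof.
  intros Hf Hg eps He.
  destruct (Hf (eps / 2)) as [d1 [Hd1 H1]]; [lra|].
  destruct (Hg (eps / 2)) as [d2 [Hd2 H2]]; [lra|].
  exists (Rmin d1 d2). split; [now apply Rmin_glb_lt|]. intros w Hw.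
  specialize (H1 w (Rlt_le_trans _ _ _ Hw (Rmin_l _ _))).
  specialize (H2 w (Rlt_le_trans _ _ _ Hw (Rmin_r _ _))).
  replace (f w - g w - (f z - g z) - (l - m) * (w - z))%C with
    ((f w - f z - l * (w - z)) + - (g w - g z - m * (w - z)))%C by ring.
  eapply Rle_trans; [apply Cmod_triangle|]. rewrite Cmod_opp. lra.
Qed.

Lemma cderiv_const (c z : C) : cderiv (fun _ => c) z 0.
Proof.
  intros eps He. exists 1; split; [lra|]. intros w _.
  replace (c - c - 0 * (w - z))%C with (RtoC 0) by ring. rewrite Cmod_0.
  apply Rmult_le_pos; [lra | apply Cmod_ge_0].
Qed.

Lemma cderiv_ext_loc f g z l e : 0 < e -> (forall w, Cmod (w - z) < e -> f w = g w) ->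
  cderiv f z l -> cderiv g z l.
Proof.
  intros He H Hf eps Heps. destruct (Hf eps Heps) as [d [Hd H1]].
  exists (Rmin d e). split; [now apply Rmin_glb_lt|]. intros w Hw.
  rewrite <- !H.
  - apply H1. eapply Rlt_le_trans; [exact Hw | apply Rmin_l].
  - rewrite Cmod_sub_self; auto.
  - eapply Rlt_le_trans; [exact Hw | apply Rmin_r].
Qed.

Lemma cderiv_unique f z l m : cderiv f z l -> cderiv f z m -> l = m.
Proof.
  intros Hl Hm. apply NNPP; intros Hne.
  assert (Hp : 0 < Cmod (l - m)).
  { apply Cmod_gt_0. intros H. apply Hne. replace l with (l - m + m)%C by ring. rewrite H. ring. }
  set (p := Cmod (l - m)) in *.
  destruct (Hl (p / 4)) as [d1 [Hd1 H1]]; [lra|].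
  destruct (Hm (p / 4)) as [d2 [Hd2 H2]]; [lra|].
  set (h := Rmin d1 d2 / 2).
  assert (Hh : 0 < h /\ h < d1 /\ h < d2).
  { assert (h1 := Rmin_l d1 d2). assert (h2 := Rmin_r d1 d2).
    assert (0 < Rmin d1 d2) by now apply Rmin_glb_lt. unfold h. lra. }
  assert (E : ((z + RtoC h) - z)%C = RtoC h) by ring.
  specialize (H1 (z + RtoC h)%C). specialize (H2 (z + RtoC h)%C).
  rewrite E, Cmod_R, Rabs_pos_eq in H1, H2 by lra.
  specialize (H1 ltac:(lra)). specialize (H2 ltac:(lra)).
  set (X := (f (z + RtoC h) - f z)%C) in *.
  assert (G : p * h <= p / 4 * h + p / 4 * h).
  { replace (p * h) with (Cmod ((X - m * h) - (X - l * h))).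
    - eapply Rle_trans; [apply Cmod_triangle|]. rewrite Cmod_opp. lra.
    - replace ((X - m * h) - (X - l * h))%C with ((l - m) * RtoC h)%C by ring.
      rewrite Cmod_mult, Cmod_R, Rabs_pos_eq by lra. reflexivity. }
  nra.
Qed.

Lemma cderiv_inv (z : C) : z <> 0 -> cderiv (fun w => / w)%C z (- (/ z * / z))%C.
Proof.
  intros Hz eps He.
  assert (Hm : 0 < Cmod z) by now apply Cmod_gt_0.
  set (m := Cmod z) in *.
  (* The error is |w - z|^2 / (m^2 |w|); the first bound gives |w| >= m / 2, and the second makes 2
     |w - z| / m^3 at most eps. *)
  exists (Rmin (m / 2) (eps * m ^ 3 / 2)).
  assert (Hm3 : 0 < m ^ 3) by now apply pow_lt.
  split; [apply Rmin_glb_lt; [lra|]; apply Rdiv_lt_0_compat; nra|]. intros w Hw.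
  assert (Hw1 := Rlt_le_trans _ _ _ Hw (Rmin_l _ _)).
  assert (Hw2 := Rlt_le_trans _ _ _ Hw (Rmin_r _ _)).
  assert (Hwm : m / 2 <= Cmod w).
  { assert (T := Cmod_triangle w (z - w)). replace (w + (z - w))%C with z in T by ring.
    rewrite (Cmod_sub_comm z) in T. fold m in T. lra. }
  assert (Hw0 : w <> 0).
  { intros E. rewrite E, Cmod_0 in Hwm. lra. }
  replace (/ w - / z - - (/ z * / z) * (w - z))%C with
    ((w - z) * ((w - z) * (/ z * / z * / w)))%C by (field; auto).
  rewrite !Cmod_mult, !Cmod_inv by auto. fold m.
  assert (Hh := Cmod_ge_0 (w - z)).
  rewrite (Rmult_comm eps). apply Rmult_le_compat_l; auto.
  assert (Hinv : / Cmod w <= 2 / m).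
  { replace (2 / m) with (/ (m / 2)) by (field; lra). apply Rinv_le_contravar; lra. }
  assert (Him : 0 < / m) by now apply Rinv_0_lt_compat.
  apply Rle_trans with (eps * m ^ 3 / 2 * (/ m * / m * (2 / m))).
  - apply Rmult_le_compat; [lra | | lra |].
    + apply Rmult_le_pos; [nra|]. left; apply Rinv_0_lt_compat; lra.
    + apply Rmult_le_compat_l; nra.
  - right. field. lra.
Qed.

(** Multiplying K by the constant c of modulus 1 that turns K(z) into |K(z)| reduces the bound at z
    to the one for real parts. *)
Lemma max_principle K K1 q r r' B : 0 < r' < r -> twice_cderiv K K1 q r ->
  (forall z, on_square_boundary q r' z -> Cmod (K z) <= B) ->
  forall z, in_csquare q r' z -> Cmod (K z) <= B.
Proof.
  intros Hr HK HB z Hz.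
  destruct (Req_dec (Cmod (K z)) 0) as [E|E].
  - rewrite E.
    (* Here K z has no phase to rotate away, but any boundary point shows 0 <= B. *)
    assert (Hb : on_square_boundary q r' ((fst q + r', snd q) : C)).
    { unfold on_square_boundary, in_csquare; simpl.
      replace (fst q + r' - fst q) with r' by ring. rewrite Rminus_diag, Rabs_R0.
      rewrite (Rabs_pos_eq r') by lra. lra. }
    eapply Rle_trans; [apply Cmod_ge_0 | exact (HB _ Hb)].
  - set (c := (Cconj (K z) / RtoC (Cmod (K z)))%C).
    assert (Hc0 : RtoC (Cmod (K z)) <> 0) by (intros H; apply E, RtoC_inj, H).
    assert (Hc : Cmod c = 1).
    { unfold c. rewrite Cmod_div, Cmod_conj, Cmod_R, Rabs_pos_eq by (auto; apply Cmod_ge_0).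
      now field. }
    assert (Hcz : (c * K z)%C = RtoC (Cmod (K z))).
    { unfold c. replace (Cconj (K z) / RtoC (Cmod (K z)) * K z)%C with
        ((K z * Cconj (K z)) / RtoC (Cmod (K z)))%C by (now field).
      rewrite <- Cmod2_conj. rewrite RtoC_pow. now field. }
    assert (G := max_principle_Re (fun z => c * K z)%C (fun z => 0 * K z + c * K1 z)%C q r r' B Hr).
    replace (Cmod (K z)) with (fst (c * K z)%C) by (rewrite Hcz; reflexivity).
    apply G; auto.
    + intros w Hw. destruct (HK w Hw) as [D1 [k2 D2]]. split.
      * apply (cderiv_mult (fun _ => c)); [apply cderiv_const | auto].
      * exists (0 * K1 w + c * k2)%C.
        apply (cderiv_ext_loc (fun z => c * K1 z)%C _ _ _ 1); [lra | intros; ring |].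
        apply (cderiv_mult (fun _ => c)); [apply cderiv_const | auto].
    + intros w Hw. eapply Rle_trans; [apply Rle_abs|].
      eapply Rle_trans; [apply fst_le_Cmod|]. rewrite Cmod_mult, Hc, Rmult_1_l. auto.
Qed.

(** * The identity theorem *)

Lemma cderiv_inv_sub (q z : C) : z <> q ->
  cderiv (fun w => / (w - q))%C z (- (/ (z - q) * / (z - q)))%C.
Proof.
  intros Hz eps He.
  assert (Hz' : (z - q)%C <> 0).
  { intros H. apply Hz. replace z with (z - q + q)%C by ring. rewrite H. ring. }
  destruct (cderiv_inv _ Hz' eps He) as [d [Hd H]]. exists d; split; auto.
  intros w Hw. specialize (H (w - q)%C).
  replace (w - q - (z - q))%C with (w - z)%C in H by ring. auto.
Qed.

(** Since K vanishes near q, the pole is invisible: the product is 0 there, whatever value [/ 0] has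
    at q. Away from q the product rule applies. The vanishing of the derivative is carried along to
    keep the induction on n going. *)
Lemma twice_cderiv_div_pow (K K1 : C -> C) q r e (n : nat) : 0 < e ->
  twice_cderiv K K1 q r ->
  (forall z, in_square q e z -> K z = 0 /\ K1 z = 0) ->
  exists M1 : C -> C, twice_cderiv (fun z => K z * (/ (z - q)) ^ n)%C M1 q r /\
    forall z, in_square q e z -> (K z * (/ (z - q)) ^ n)%C = 0 /\ M1 z = 0.
Proof.
  intros He HK H0. induction n as [|n [M1 [HM HM0]]].
  - exists K1. split.
    + intros z Hz. destruct (HK z Hz) as [D1 D2]. split; auto.
      apply (cderiv_ext_loc K _ _ _ 1); auto; [lra|]. intros w _. simpl. ring.
    + intros z Hz. destruct (H0 z Hz) as [E1 E2]. rewrite E1. split; auto. ring.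
  - set (M := fun z => (K z * (/ (z - q)) ^ n)%C) in *.
    exists (fun z => M1 z * / (z - q) + M z * - (/ (z - q) * / (z - q)))%C. split.
    2:{ intros z Hz. destruct (HM0 z Hz) as [E1 E2]. destruct (H0 z Hz) as [E3 _].
        unfold M. rewrite E2, E3. split; ring. }
    intros z Hz. destruct (classic (in_square q e z)) as [Hze|Hze].
    + destruct (in_square_open _ _ _ Hze) as [d [Hd Hdz]].
      destruct (HM0 z Hze) as [E1 E2]. split.
      * unfold M. rewrite E1, E2.
        replace (0 * / (z - q) + 0 * - (/ (z - q) * / (z - q)))%C with (RtoC 0) by ring.
        apply (cderiv_ext_loc (fun _ => RtoC 0) _ _ _ d Hd); [|apply cderiv_const].
        intros w Hw. destruct (H0 w (Hdz w Hw)) as [E _]. rewrite E. ring.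
      * exists 0. apply (cderiv_ext_loc (fun _ => RtoC 0) _ _ _ d Hd); [|apply cderiv_const].
        intros w Hw. destruct (HM0 w (Hdz w Hw)) as [E E']. unfold M. rewrite E, E'. ring.
    + assert (Hzq : z <> q) by (intros ->; apply Hze; now apply in_square_center).
      destruct (HM z Hz) as [D1 [k D2]]. assert (J := cderiv_inv_sub q z Hzq). split.
      * apply (cderiv_ext_loc (fun w => M w * / (w - q))%C _ _ _ 1); [lra | |].
        { intros w _. unfold M. simpl. ring. }
        apply (cderiv_mult M (fun w => / (w - q))%C); auto.
      * eexists. apply (cderiv_ext_loc
          (fun w => M1 w * / (w - q) - M w * (/ (w - q) * / (w - q)))%C _ _ _ 1);
          [lra | intros w _; ring |].
        apply cderiv_minus; [apply (cderiv_mult M1 (fun w => / (w - q))%C); eassumption|].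
        apply (cderiv_mult M (fun w => / (w - q) * / (w - q))%C); [eassumption|].
        apply (cderiv_mult (fun w => / (w - q))%C (fun w => / (w - q))%C); eassumption.
Qed.

(* The maximum principle for K / (z - q)^n bounds |K z| by a multiple of
   (|z - q| / r')^n for every n. *)
Lemma twice_cderiv_vanish (K K1 : C -> C) q r e r' : 0 < e -> 0 < r' < r ->
  twice_cderiv K K1 q r -> (forall z, in_square q e z -> K z = 0 /\ K1 z = 0) ->
  forall z, Cmod (z - q) < r' -> K z = 0.
Proof.
  intros He Hr HK H0 z Hz.
  destruct (csquare_max (fun z => Cmod (K z)) q r') as [m [Hm Hmax]]; [lra | |].
  { intros w Hw eps Heps.
    destruct (HK w) as [D _]. { destruct Hw; split; lra. }
    destruct (cderiv_ccont _ _ _ D eps Heps) as [d [Hd H]]. exists d; split; auto.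
    intros v _ Hv. eapply Rle_lt_trans; [|apply (H v Hv)].
    assert (T1 := Cmod_triangle (K w) (K v - K w)).
    assert (T2 := Cmod_triangle (K v) (K w - K v)).
    replace (K w + (K v - K w))%C with (K v) in T1 by ring.
    replace (K v + (K w - K v))%C with (K w) in T2 by ring.
    rewrite (Cmod_sub_comm (K w)) in T2. apply Rabs_le. lra. }
  set (B := Cmod (K m)) in *.
  destruct (classic (z = q)) as [->|Hzq]; [now apply H0, in_square_center|].
  assert (Hz0 : (z - q)%C <> 0).
  { intros H. apply Hzq. replace z with (z - q + q)%C by ring. rewrite H. ring. }
  assert (Hpz : 0 < Cmod (z - q)) by now apply Cmod_gt_0.
  assert (Hbound : forall n, Cmod (K z) <= B * (Cmod (z - q) / r') ^ n).
  { intros n. destruct (twice_cderiv_div_pow K K1 q r e n He HK H0) as [M1 [HM _]].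
    assert (G : Cmod (K z * (/ (z - q)) ^ n) <= B * (/ r') ^ n).
    { apply (max_principle _ _ _ _ _ _ Hr HM).
      - intros w [Hw Hb].
        assert (Hwr : r' <= Cmod (w - q)).
        { destruct (Cmod_sub_bounds w q) as [B1 [B2 _]]. destruct Hb; lra. }
        assert (Hw0 : (w - q)%C <> 0) by (apply Cmod_gt_0; lra).
        rewrite Cmod_mult, Cmod_pow, Cmod_inv by auto.
        apply Rmult_le_compat; [apply Cmod_ge_0 | | now apply Hmax |].
        + apply pow_le. left. apply Rinv_0_lt_compat. lra.
        + apply pow_incr. split; [left; apply Rinv_0_lt_compat; lra|].
          apply Rinv_le_contravar; lra.
      - destruct (Cmod_sub_bounds z q) as [B1 [B2 _]]. split; lra. }
    rewrite Cmod_mult, Cmod_pow, Cmod_inv in G by auto.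
    apply (Rmult_le_compat_r (Cmod (z - q) ^ n)) in G; [|apply pow_le; lra].
    rewrite !Rmult_assoc, <- !Rpow_mult_distr in G.
    replace (/ Cmod (z - q) * Cmod (z - q)) with 1 in G by (field; lra).
    rewrite pow1, Rmult_1_r, (Rmult_comm (/ r')) in G. exact G. }
  apply Cmod_eq_0. apply Rle_antisym; [|apply Cmod_ge_0].
  apply Rnot_lt_le; intros Hpos.
  assert (HB : 0 <= B) by apply Cmod_ge_0.
  assert (Hq0 : 0 <= Cmod (z - q) / r') by (left; apply Rdiv_lt_0_compat; lra).
  destruct (pow_lt_1_zero (Cmod (z - q) / r')) with (y := Cmod (K z) / (B + 1)) as [n Hn].
  - rewrite Rabs_pos_eq by auto. apply Rmult_lt_reg_r with r'; [lra|].
    replace (Cmod (z - q) / r' * r') with (Cmod (z - q)) by (field; lra). lra.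
  - apply Rdiv_lt_0_compat; lra.
  - specialize (Hn n (Nat.le_refl n)). specialize (Hbound n).
    rewrite Rabs_pos_eq in Hn by (now apply pow_le).
    assert (P := pow_le _ n Hq0).
    apply (Rmult_lt_compat_l (B + 1)) in Hn; [|lra].
    replace ((B + 1) * (Cmod (K z) / (B + 1))) with (Cmod (K z)) in Hn by (field; lra). lra.
Qed.

Definition holo (f : C -> C) (c : C) (r : R) : Prop :=
  forall z, Cmod (z - c) < r -> exists l, cderiv f z l.

(** The maximum principle does not apply to f, which is known to be differentiable only once; it
    applies to G with G' = F and F' = f. Differentiating G = 0 twice on the open disc returns f =
    0. *)
Lemma holo_square_vanish (f : C -> C) q r e r' : 0 < e -> 0 < r' < r ->
  (forall z, in_square q r z -> exists l, cderiv f z l) ->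
  (forall z, in_square q e z -> f z = 0) ->
  forall z, Cmod (z - q) < r' -> f z = 0.
Proof.
  intros He Hr Hf H0.
  assert (HF := prim_cderiv f q r).
  set (F := prim f q) in *. set (G := prim F q).
  assert (HG : forall z, in_square q r z -> cderiv G z (F z)).
  { intros z Hz. apply (prim_cderiv F q r); try lra; auto.
    intros w Hw. eexists. apply HF; auto; lra. }
  assert (F0 : forall z, in_square q e z -> F z = 0)
    by (intros z; now apply prim_zero).
  assert (Gv : forall z, Cmod (z - q) < r' -> G z = 0).
  { apply (twice_cderiv_vanish G F q r e r'); auto.
    - intros z Hz. split; auto. eexists; apply HF; auto; lra.
    - intros z Hz. split; auto. now apply (prim_zero F q e). }
  assert (Hsq : forall z, Cmod (z - q) < r' -> in_square q r z).
  { intros z Hz. destruct (Cmod_sub_bounds z q) as [B1 [B2 _]]. split; lra. }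
  assert (Hder : forall (K L : C -> C), (forall z, in_square q r z -> cderiv K z (L z)) ->
    (forall z, Cmod (z - q) < r' -> K z = 0) -> forall z, Cmod (z - q) < r' -> L z = 0).
  { intros K L HKL HK z Hz. apply (cderiv_unique K z); auto.
    apply (cderiv_ext_loc (fun _ => RtoC 0) _ _ _ (r' - Cmod (z - q))); [lra | |apply cderiv_const].
    intros w Hw. symmetry. apply HK.
    eapply Rle_lt_trans; [apply (Cmod_sub_triangle z)|]. lra. }
  apply (Hder F f); [intros; apply HF; auto; lra|]. now apply (Hder G F).
Qed.

Definition near_eq (f g : C -> C) (p : C) : Prop :=
  exists eps, 0 < eps /\ forall z, Cmod (z - p) < eps -> f z = g z.

(** The square of half-side r / 4 about q lies in the disc of radius r about p, since 1/16 + 1/4 +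
    1/4 < 1, and the disc of radius r / 8 about q contains that of radius r / 16 about p. The square
    of half-side e / 2 lies in the disc of radius e. *)
Lemma holo_identity (f g : C -> C) p q r : holo f p r -> holo g p r ->
  Cmod (q - p) < r / 16 -> near_eq f g q -> near_eq f g p.
Proof.
  intros Hf Hg Hq [e [He H]].
  assert (Hr : 0 < r) by (assert (h := Cmod_ge_0 (q - p)); lra).
  exists (r / 16). split; [lra|]. intros z Hz.
  assert (E : (f z - g z)%C = 0).
  2:{ replace (f z) with (f z - g z + g z)%C by ring. rewrite E. ring. }
  apply (holo_square_vanish (fun z => f z - g z)%C q (r / 4) (e / 2) (r / 8)); try lra.
  - intros w [W1 W2].
    assert (Hw : Cmod (w - p) < r).
    { assert (T := Cmod_sub_triangle q w p). destruct (Cmod_sub_bounds w q) as [_ [_ B]]. lra. }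
    destruct (Hf w Hw) as [l Hl], (Hg w Hw) as [m Hm]. exists (l - m)%C. now apply cderiv_minus.
  - intros w [W1 W2]. rewrite H; [ring|].
    destruct (Cmod_sub_bounds w q) as [_ [_ B]]. lra.
  - assert (T := Cmod_sub_triangle p z q). rewrite (Cmod_sub_comm p q) in T. lra.
Qed.

(** * Analytic continuation along a path *)

Lemma holo_on_disc_holo f c r : holo_on_disc f c r -> holo f c r.
Proof.
  intros H z Hz. destruct (H z Hz) as [l Hl]. exists l. now apply is_derive_cderiv.
Qed.

Lemma holo_on_disc_sub f c r c' r' : holo_on_disc f c r -> Cmod (c' - c) + r' <= r ->
  holo_on_disc f c' r'.
Proof.
  intros H Hc z Hz. apply H. assert (T := Cmod_sub_triangle c' z c).
  unfold Cminus in *. lra.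
Qed.

Lemma near_eq_refl f p : near_eq f f p.
Proof. exists 1; split; [lra | auto]. Qed.

Lemma near_eq_sym f g p : near_eq f g p -> near_eq g f p.
Proof. intros [e [He H]]. exists e; split; auto. intros z Hz. symmetry; auto. Qed.

Lemma near_eq_trans f g h p : near_eq f g p -> near_eq g h p -> near_eq f h p.
Proof.
  intros [e [He H]] [e' [He' H']]. exists (Rmin e e'). split; [now apply Rmin_glb_lt|].
  intros z Hz. rewrite H, H'; auto; eapply Rlt_le_trans; eauto; [apply Rmin_r | apply Rmin_l].
Qed.

Lemma near_eq_open f g p : near_eq f g p ->
  exists e, 0 < e /\ forall q, Cmod (q - p) < e -> near_eq f g q.
Proof.
  intros [e [He H]]. exists e; split; auto. intros q Hq.
  exists (e - Cmod (q - p)). split; [lra|]. intros z Hz. apply H.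
  assert (T := Cmod_sub_triangle q z p). lra.
Qed.

(** Take the supremum m of the times where P holds: the backward clause at m gives P m, and the
    forward clause would carry P beyond m if m < t. *)
Lemma interval_induction (P : R -> Prop) s t : s <= t -> P s ->
  (forall u, s <= u <= t -> exists d, 0 < d /\ forall v, s <= v <= t -> Rabs (v - u) < d ->
    (v <= u -> P v -> P u) /\ (u <= v -> P u -> P v)) ->
  P t.
Proof.
  intros Hst Hs Hstep.
  destruct (completeness (fun u => s <= u <= t /\ P u)) as [m [Hm1 Hm2]].
  - exists t. intros u [Hu _]. lra.
  - exists s. split; auto; lra.
  - assert (Hm : s <= m <= t).
    { split; [apply Hm1; split; auto; lra|]. apply Hm2. intros u [Hu _]. lra. }
    destruct (Hstep m Hm) as [d [Hd H]].
    assert (HPm : P m).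
    { apply NNPP; intros HN. assert (m <= m - d / 2); [|lra].
      apply Hm2. intros u [Hu HPu]. apply Rnot_lt_le; intros Hlt.
      assert (Hum : u <= m) by (apply Hm1; auto).
      apply HN. apply (H u); auto. apply Rabs_def1; lra. }
    destruct (Rle_lt_dec t m) as [Htm|Htm]; [replace t with m by lra; auto|].
    exfalso. set (v := Rmin t (m + d / 2)).
    assert (Hv : m < v <= t /\ v <= m + d / 2).
    { split; [split|]; [apply Rmin_glb_lt; lra | apply Rmin_l | apply Rmin_r]. }
    assert (HPv : P v) by (apply (H v); auto; try apply Rabs_def1; lra).
    assert (v <= m) by (apply Hm1; split; auto; lra). lra.
Qed.

Definition pcont (gamma : R -> C) (s t : R) : Prop :=
  forall u, s <= u <= t -> forall eps, 0 < eps -> exists d, 0 < d /\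
    forall v, s <= v <= t -> Rabs (v - u) < d -> Cmod (gamma v - gamma u) < eps.

(* A compatible family of germs f u, each holomorphic on the disc of radius r u about
   gamma u: the continuation data of [continuable_along], on an arbitrary interval. *)
Definition germ_family (gamma : R -> C) (s t : R) (f : R -> C -> C) (r : R -> R) : Prop :=
  (forall u, s <= u <= t -> 0 < r u /\ holo_on_disc (f u) (gamma u) (r u)) /\
  (forall u, s <= u <= t -> exists d, 0 < d /\
     forall v, s <= v <= t -> Rabs (v - u) < d ->
       Cmod (gamma v - gamma u) < r u /\ near_eq (f v) (f u) (gamma v)).

Definition is_germ_of (a : nat -> C) (h : C -> C) : Prop :=
  exists eps, 0 < eps /\ forall z, Cmod z < eps ->
    @is_series C_AbsRing C_NormedModule (fun n => Cmult (a n) (Cpow z n)) (h z).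

Lemma continuable_alongE a gamma T : continuable_along a gamma T <->
  exists f r, germ_family gamma 0 T f r /\ is_germ_of a (f 0).
Proof.
  split.
  - intros [f [r [H1 [H2 H3]]]]. exists f, r. split; [split|]; auto.
  - intros [f [r [[H1 H3] H2]]]. exists f, r. split; [|split]; auto.
Qed.

Lemma is_germ_of_unique a h h' : is_germ_of a h -> is_germ_of a h' -> near_eq h h' 0.
Proof.
  intros [e [He H]] [e' [He' H']]. exists (Rmin e e'). split; [now apply Rmin_glb_lt|].
  intros z Hz. replace (z - 0)%C with z in Hz by ring.
  assert (S1 := H z (Rlt_le_trans _ _ _ Hz (Rmin_l _ _))).
  assert (S2 := H' z (Rlt_le_trans _ _ _ Hz (Rmin_r _ _))).
  exact (@filterlim_locally_unique nat C_AbsRing C_NormedModule eventually _ _ _ _ S1 S2).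
Qed.

Lemma germ_family_sub gamma s t s' t' f r : s <= s' -> t' <= t ->
  germ_family gamma s t f r -> germ_family gamma s' t' f r.
Proof.
  intros Hs Ht [H1 H2]. split; intros u Hu; [apply H1; lra|].
  destruct (H2 u) as [d [Hd H]]; [lra|]. exists d; split; auto.
  intros v Hv. apply H; lra.
Qed.

Lemma germ_family_ext gamma gamma' s t f r :
  (forall u, s <= u <= t -> gamma u = gamma' u) ->
  germ_family gamma s t f r -> germ_family gamma' s t f r.
Proof.
  intros E [H1 H2]. split; intros u Hu.
  - rewrite <- E by auto. now apply H1.
  - destruct (H2 u Hu) as [d [Hd H]]. exists d; split; auto.
    intros v Hv. rewrite <- !E by auto. now apply H.
Qed.

Lemma germ_family_reparam gamma s t f r a b : 0 < b ->
  germ_family gamma (a + b * s) (a + b * t) f r ->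
  germ_family (fun x => gamma (a + b * x)) s t (fun x => f (a + b * x)) (fun x => r (a + b * x)).
Proof.
  intros Hb [H1 H2].
  assert (M : forall u, s <= u <= t -> a + b * s <= a + b * u <= a + b * t) by (intros; nra).
  split; intros u Hu; [now apply H1, M|].
  destruct (H2 _ (M u Hu)) as [d [Hd H]]. exists (d / b).
  split; [now apply Rdiv_lt_0_compat|]. intros v Hv Hvu. apply H; [now apply M|].
  replace (a + b * v - (a + b * u)) with (b * (v - u)) by ring.
  rewrite Rabs_mult, (Rabs_pos_eq b) by lra.
  apply (Rmult_lt_compat_l b) in Hvu; auto.
  replace (b * (d / b)) with d in Hvu by (field; lra). auto.
Qed.

(** The radius at time u is what remains of the disc about c when it is recentred at [gamma u]. *)
Lemma germ_family_const gamma s t h c r : pcont gamma s t -> holo_on_disc h c r ->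
  (forall u, s <= u <= t -> Cmod (gamma u - c) < r) ->
  germ_family gamma s t (fun _ => h) (fun u => r - Cmod (gamma u - c)).
Proof.
  intros Hc Hh Hr. split; intros u Hu; specialize (Hr u Hu).
  - split; [lra|]. apply (holo_on_disc_sub h c r); auto. lra.
  - destruct (Hc u Hu (r - Cmod (gamma u - c))) as [d [Hd H]]; [lra|].
    exists d; split; auto. intros v Hv Hvu. split; [auto | apply near_eq_refl].
Qed.

(** Only the junction needs care: just after t the germ of [g v] is that of [g t], which agrees with
    [f t] near [gamma t]. Continuity of the path keeps [gamma v] in the disc of [f t]. At other
    times delta is shrunk to stay on one side of t. *)
Lemma germ_family_concat gamma s t u f r g q : s <= t <= u -> pcont gamma s u ->
  germ_family gamma s t f r -> germ_family gamma t u g q ->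
  near_eq (f t) (g t) (gamma t) ->
  germ_family gamma s u (fun x => if Rle_dec x t then f x else g x)
    (fun x => if Rle_dec x t then r x else q x).
Proof.
  intros Hst Hc [F1 F2] [G1 G2] Hn. split; intros x Hx.
  - destruct (Rle_dec x t); [apply F1 | apply G1]; lra.
  - destruct (Rtotal_order x t) as [Hxt|[->|Hxt]].
    + destruct (F2 x) as [d [Hd H]]; [lra|].
      exists (Rmin d (t - x)). split; [apply Rmin_glb_lt; lra|]. intros v Hv Hvx.
      assert (A1 := Rlt_le_trans _ _ _ Hvx (Rmin_l _ _)).
      assert (A2 := Rlt_le_trans _ _ _ Hvx (Rmin_r _ _)). apply Rabs_def2 in A2.
      destruct (Rle_dec x t); [|lra]. destruct (Rle_dec v t); [|lra]. apply H; auto; lra.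
    + destruct (F2 t) as [d [Hd H]]; [lra|]. destruct (G2 t) as [d' [Hd' H']]; [lra|].
      destruct (near_eq_open _ _ _ Hn) as [e [He Hopen]].
      destruct (F1 t) as [Hrt _]; [lra|].
      destruct (Hc t Hx (Rmin e (r t))) as [d2 [Hd2 H2]]; [now apply Rmin_glb_lt|].
      exists (Rmin d (Rmin d' d2)). split; [repeat apply Rmin_glb_lt; lra|].
      intros v Hv Hvx.
      assert (A1 := Rlt_le_trans _ _ _ Hvx (Rmin_l _ _)).
      assert (A := Rlt_le_trans _ _ _ Hvx (Rmin_r _ _)).
      assert (A2 := Rlt_le_trans _ _ _ A (Rmin_l _ _)).
      assert (A3 := Rlt_le_trans _ _ _ A (Rmin_r _ _)).
      destruct (Rle_dec t t); [|lra]. destruct (Rle_dec v t).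
      * apply H; auto; lra.
      * specialize (H2 v Hv A3). split.
        { eapply Rlt_le_trans; [exact H2 | apply Rmin_r]. }
        apply near_eq_trans with (g t); [apply H'; auto; lra|].
        apply near_eq_sym, Hopen. eapply Rlt_le_trans; [exact H2 | apply Rmin_l].
    + destruct (G2 x) as [d [Hd H]]; [lra|].
      exists (Rmin d (x - t)). split; [apply Rmin_glb_lt; lra|]. intros v Hv Hvx.
      assert (A1 := Rlt_le_trans _ _ _ Hvx (Rmin_l _ _)).
      assert (A2 := Rlt_le_trans _ _ _ Hvx (Rmin_r _ _)). apply Rabs_def2 in A2.
      destruct (Rle_dec x t); [lra|]. destruct (Rle_dec v t); [lra|]. apply H; auto; lra.
Qed.

(** Equality of germs spreads forward because it is an open condition; the backward clause, from
    [gamma v] to the limit point [gamma u], is the identity theorem. *)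
Lemma germ_family_unique gamma s t f r g q : s <= t -> pcont gamma s t ->
  germ_family gamma s t f r -> germ_family gamma s t g q ->
  near_eq (f s) (g s) (gamma s) -> near_eq (f t) (g t) (gamma t).
Proof.
  intros Hst Hc [F1 F2] [G1 G2] Hs.
  apply (interval_induction (fun u => near_eq (f u) (g u) (gamma u)) s t Hst Hs).
  intros u Hu.
  destruct (F1 u Hu) as [Hr Hf], (G1 u Hu) as [Hq Hg].
  destruct (F2 u Hu) as [d1 [Hd1 H1]], (G2 u Hu) as [d2 [Hd2 H2]].
  set (rho := Rmin (r u) (q u)). assert (Hrho : 0 < rho) by now apply Rmin_glb_lt.
  (* The radius must be fixed before it is known whether the germs agree at u, hence the conditional
     form. *)
  assert (He : exists e, 0 < e /\ (near_eq (f u) (g u) (gamma u) ->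
    forall z, Cmod (z - gamma u) < e -> near_eq (f u) (g u) z)).
  { destruct (classic (near_eq (f u) (g u) (gamma u))) as [Hn|Hn].
    - destruct (near_eq_open _ _ _ Hn) as [e [He H]]. exists e; auto.
    - exists 1; split; [lra | tauto]. }
  destruct He as [e [He Hopen]].
  destruct (Hc u Hu (Rmin e (rho / 16))) as [d3 [Hd3 H3]]; [apply Rmin_glb_lt; lra|].
  exists (Rmin d1 (Rmin d2 d3)). split; [repeat apply Rmin_glb_lt; lra|]. intros v Hv Hvx.
  assert (A1 := Rlt_le_trans _ _ _ Hvx (Rmin_l _ _)).
  assert (A := Rlt_le_trans _ _ _ Hvx (Rmin_r _ _)).
  assert (A2 := Rlt_le_trans _ _ _ A (Rmin_l _ _)).
  assert (A3 := Rlt_le_trans _ _ _ A (Rmin_r _ _)).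
  destruct (H1 v Hv A1) as [_ N1]. destruct (H2 v Hv A2) as [_ N2].
  specialize (H3 v Hv A3).
  assert (Hve := Rlt_le_trans _ _ _ H3 (Rmin_l _ _)).
  assert (Hvr := Rlt_le_trans _ _ _ H3 (Rmin_r _ _)).
  split; intros _ HP.
  - apply (holo_identity _ _ _ (gamma v) rho); auto.
    + apply holo_on_disc_holo, (holo_on_disc_sub _ _ _ _ _ Hf).
      rewrite Cmod_sub_self. assert (h := Rmin_l (r u) (q u)). fold rho in h. lra.
    + apply holo_on_disc_holo, (holo_on_disc_sub _ _ _ _ _ Hg).
      rewrite Cmod_sub_self. assert (h := Rmin_r (r u) (q u)). fold rho in h. lra.
    + apply near_eq_trans with (f v); [now apply near_eq_sym|].
      apply near_eq_trans with (g v); auto.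
  - apply near_eq_trans with (f u); auto. apply near_eq_trans with (g u); auto.
    now apply near_eq_sym.
Qed.

(** * Lengths of paths *)

Lemma partition_mono t p n : partition_of t p n -> forall i, (i <= n)%nat -> 0 <= p i <= t.
Proof.
  intros [H0 [Hn Hm]].
  assert (M : forall i k, (i + k <= n)%nat -> p i <= p (i + k)%nat).
  { intros i k. induction k as [|k IH]; intros Hk; [rewrite Nat.add_0_r; lra|].
    rewrite Nat.add_succ_r. assert (h1 := IH ltac:(lia)).
    assert (h2 := Hm (i + k)%nat ltac:(lia)). lra. }
  intros i Hi. rewrite <- H0, <- Hn. split.
  - apply (M 0%nat i). lia.
  - replace n with (i + (n - i))%nat by lia. apply M. lia.
Qed.

Lemma var_sum_le gamma K t p n :
  (forall u v, 0 <= u <= t -> 0 <= v <= t -> Cmod (gamma u - gamma v) <= K * Rabs (u - v)) ->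
  partition_of t p n -> var_sum gamma p n <= K * t.
Proof.
  intros HK Hp. assert (M := partition_mono t p n Hp). destruct Hp as [H0 [Hn Hm]].
  assert (G : forall k, (k <= n)%nat -> var_sum gamma p k <= K * p k).
  { induction k as [|k IH]; intros Hk; simpl; [rewrite H0; lra|].
    assert (h := HK (p (S k)) (p k) (M (S k) Hk) (M k ltac:(lia))).
    assert (h' := Hm k Hk). rewrite Rabs_pos_eq in h by lra.
    assert (h'' := IH ltac:(lia)). lra. }
  rewrite <- Hn. apply G. lia.
Qed.

Lemma trivial_partition t : 0 <= t -> partition_of t (fun i => match i with O => 0 | S _ => t end) 1.
Proof.
  intros Ht. split; [|split]; auto. intros i Hi. destruct i; [auto | lia].
Qed.

(** [real] sends infinite bounds to 0, so the supremum must be shown finite: B bounds it above, and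
    the one-step partition excludes minus infinity. *)
Lemma path_length_le gamma t B : 0 <= t ->
  (forall p n, partition_of t p n -> var_sum gamma p n <= B) -> path_length gamma t <= B.
Proof.
  intros Ht HB. unfold path_length.
  match goal with |- context [Lub_Rbar ?X] => set (E := X) end. destruct (Lub_Rbar_correct E) as [Hub Hlub].
  assert (H1 : Rbar_le (Lub_Rbar E) B).
  { apply Hlub. intros l [p [n [Hp ->]]]. now apply HB. }
  assert (H2 : Rbar_le (var_sum gamma (fun i => match i with O => 0 | S _ => t end) 1) (Lub_Rbar E)).
  { apply Hub. do 2 eexists. split; [now apply trivial_partition | reflexivity]. }
  destruct (Lub_Rbar E); simpl in *; tauto.
Qed.

Lemma path_length_le_lip gamma K t : 0 <= t ->
  (forall u v, 0 <= u <= t -> 0 <= v <= t -> Cmod (gamma u - gamma v) <= K * Rabs (u - v)) ->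
  path_length gamma t <= K * t.
Proof. intros Ht HK. apply path_length_le; auto. intros. now apply var_sum_le. Qed.

Lemma var_sum_le_path_length gamma T t p n : lipschitz_on gamma T -> 0 <= t <= T ->
  partition_of t p n -> var_sum gamma p n <= path_length gamma t.
Proof.
  intros [K HK] Ht Hp. unfold path_length.
  match goal with |- context [Lub_Rbar ?X] => set (E := X) end. destruct (Lub_Rbar_correct E) as [Hub Hlub].
  assert (H1 : Rbar_le (Lub_Rbar E) (K * t)).
  { apply Hlub. intros l [p' [n' [Hp' ->]]]. apply (var_sum_le gamma K t p' n'); auto.
    intros u v Hu Hv. apply HK; lra. }
  assert (H2 : Rbar_le (var_sum gamma p n) (Lub_Rbar E)) by (apply Hub; now exists p, n).
  destruct (Lub_Rbar E); simpl in *; tauto.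
Qed.

(** Appending t to a partition of [0, s] adds the chord to its variation sum. This one-sided form of
    additivity suffices for all length estimates below. *)
Lemma path_length_add gamma T s t : lipschitz_on gamma T -> 0 <= s <= t -> t <= T ->
  path_length gamma s + Cmod (gamma t - gamma s) <= path_length gamma t.
Proof.
  intros HL Hs Ht.
  assert (H : path_length gamma s <= path_length gamma t - Cmod (gamma t - gamma s)).
  2:{ lra. }
  apply path_length_le; [lra|]. intros p n Hp.
  set (p' := fun i => if Nat.leb i n then p i else t).
  assert (Ep : forall i, (i <= n)%nat -> p' i = p i).
  { intros i Hi. unfold p'. apply Nat.leb_le in Hi. now rewrite Hi. }
  assert (Et : p' (S n) = t).
  { unfold p'. now rewrite (proj2 (Nat.leb_gt (S n) n) (Nat.lt_succ_diag_r n)). }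
  assert (Ev : forall k, (k <= n)%nat -> var_sum gamma p' k = var_sum gamma p k).
  { induction k as [|k IH]; intros Hk; simpl; auto. rewrite IH, !Ep by lia. reflexivity. }
  assert (Hp' : partition_of t p' (S n)).
  { destruct Hp as [H0 [Hn Hm]]. split; [exact H0 | split; [exact Et|]].
    intros i Hi. destruct (Nat.eq_dec i n) as [->|Hne].
    - rewrite Et, Ep by lia. lra.
    - rewrite !Ep by lia. apply Hm. lia. }
  assert (G := var_sum_le_path_length gamma T t p' (S n) HL ltac:(lra) Hp').
  cbn [var_sum] in G. rewrite Et, Ev, (Ep n), (proj1 (proj2 Hp)) in G by lia. lra.
Qed.

Lemma path_length_ge_0 gamma T t : lipschitz_on gamma T -> 0 <= t <= T -> 0 <= path_length gamma t.
Proof.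
  intros HL Ht.
  eapply Rle_trans; [|apply (var_sum_le_path_length gamma T t _ 1 HL Ht (trivial_partition t (proj1 Ht)))].
  simpl. rewrite Rplus_0_l. apply Cmod_ge_0.
Qed.

Lemma path_length_mono gamma T s t : lipschitz_on gamma T -> 0 <= s <= t -> t <= T ->
  path_length gamma s <= path_length gamma t.
Proof.
  intros HL Hs Ht. assert (h := path_length_add gamma T s t HL Hs Ht).
  assert (h' := Cmod_ge_0 (gamma t - gamma s)). lra.
Qed.

Lemma Cmod_le_path_length gamma T t : in_Pi gamma T -> 0 <= t <= T ->
  Cmod (gamma t) <= path_length gamma t.
Proof.
  intros [H0 [HL Hg]] Ht.
  assert (h := path_length_add gamma T 0 t HL ltac:(lra) ltac:(lra)).
  assert (h' := path_length_ge_0 gamma T 0 HL ltac:(lra)).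
  rewrite Hg in h. replace (gamma t - RtoC 0)%C with (gamma t) in h by ring. lra.
Qed.

Lemma in_Pi_sub gamma T t : in_Pi gamma T -> 0 <= t <= T -> in_Pi gamma t.
Proof.
  intros [H0 [[K HK] Hg]] Ht. split; [lra|]. split; auto.
  exists K. intros u v Hu Hv. apply HK; lra.
Qed.

Lemma lipschitz_pos gamma T : lipschitz_on gamma T -> exists K, 0 < K /\
  forall u v, 0 <= u <= T -> 0 <= v <= T -> Cmod (gamma u - gamma v) <= K * Rabs (u - v).
Proof.
  intros [K HK]. exists (Rmax K 1). split; [eapply Rlt_le_trans; [|apply Rmax_r]; lra|].
  intros u v Hu Hv. eapply Rle_trans; [apply HK; auto|].
  apply Rmult_le_compat_r; [apply Rabs_pos | apply Rmax_l].
Qed.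

Lemma lip_pcont gamma s t K : 0 < K ->
  (forall u v, s <= u <= t -> s <= v <= t -> Cmod (gamma u - gamma v) <= K * Rabs (u - v)) ->
  pcont gamma s t.
Proof.
  intros HK H u Hu eps He. exists (eps / K). split; [now apply Rdiv_lt_0_compat|].
  intros v Hv Hvu. eapply Rle_lt_trans; [now apply H|].
  apply (Rmult_lt_compat_l K) in Hvu; auto.
  replace (K * (eps / K)) with eps in Hvu by (field; lra). auto.
Qed.

Lemma in_Pi_pcont gamma T : in_Pi gamma T -> pcont gamma 0 T.
Proof.
  intros [_ [HL _]]. destruct (lipschitz_pos _ _ HL) as [K [HK H]]. now apply (lip_pcont _ _ _ K).
Qed.

(** * Polygons avoiding a finite set *)

(* ((a, b), k) stands for the line a x + b y = k. *)
Definition on_line (l : R * R * R) (z : C) : Prop :=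
  fst (fst l) * fst z + snd (fst l) * snd z = snd l.

Definition proper_line (l : R * R * R) : Prop := fst (fst l) <> 0 \/ snd (fst l) <> 0.

(** For each line in turn, the centre is pushed off it if necessary and the ball is shrunk. A whole
    ball, not just a point, is kept so that the next push cannot return to an earlier line. *)
Lemma ball_avoiding_lines (ls : list (R * R * R)) : List.Forall proper_line ls ->
  forall c eta, 0 < eta -> exists c' eta', 0 < eta' /\ forall z, Cmod (z - c') < eta' ->
    Cmod (z - c) < eta /\ List.Forall (fun l => ~ on_line l z) ls.
Proof.
  intros Hls. induction Hls as [|[[a b] k] ls Hl Hls IH]; intros c eta Heta.
  - exists c, eta. split; auto.
  - destruct (IH c eta Heta) as [c' [eta' [He' H']]].
    unfold proper_line in Hl. simpl in Hl.
    set (S := Rabs a + Rabs b).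
    assert (HS : 0 < S).
    { unfold S. assert (ha := Rabs_pos a). assert (hb := Rabs_pos b).
      destruct Hl as [Hl|Hl]; apply Rabs_pos_lt in Hl; lra. }
    assert (Hc : exists c'' : C, Cmod (c'' - c') <= eta' / 2 /\ a * fst c'' + b * snd c'' - k <> 0).
    { destruct (Req_dec (a * fst c' + b * snd c' - k) 0) as [E|E].
      (* A push along the normal (a, b): its modulus is at most eta' / 2, and it changes a x + b y
         by eta' / (2 S) times a^2 + b^2 > 0. *)
      - exists (fst c' + eta' / 2 * (a / S), snd c' + eta' / 2 * (b / S)). split.
        + eapply Rle_trans; [apply Cmod_sub_bounds|]. simpl.
          replace (fst c' + eta' / 2 * (a / S) - fst c') with (eta' / 2 / S * a) by (field; lra).
          replace (snd c' + eta' / 2 * (b / S) - snd c') with (eta' / 2 / S * b) by (field; lra).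
          rewrite !Rabs_mult, (Rabs_pos_eq (eta' / 2 / S)).
          * right. fold S. replace (eta' / 2 / S * Rabs a + eta' / 2 / S * Rabs b)
              with (eta' / 2 / S * S) by (unfold S; ring). field; lra.
          * left. apply Rdiv_lt_0_compat; lra.
        + simpl. replace (a * (fst c' + eta' / 2 * (a / S)) + b * (snd c' + eta' / 2 * (b / S)) - k)
            with ((a * fst c' + b * snd c' - k) + eta' / 2 / S * (a ^ 2 + b ^ 2)) by (field; lra).
          rewrite E, Rplus_0_l. apply Rgt_not_eq. apply Rmult_lt_0_compat.
          * apply Rdiv_lt_0_compat; lra.
          * destruct Hl as [Hl|Hl]; apply pow2_gt_0 in Hl;
              assert (h1 := pow2_ge_0 a); assert (h2 := pow2_ge_0 b); lra.
      - exists c'. split; auto. rewrite Cmod_sub_self. lra. }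
    destruct Hc as [c'' [Hc'' Hv]]. set (v := a * fst c'' + b * snd c'' - k) in *.
    apply Rabs_pos_lt in Hv.
    exists c'', (Rmin (eta' / 2) (Rabs v / S)).
    split; [apply Rmin_glb_lt; [lra | now apply Rdiv_lt_0_compat]|]. intros z Hz.
    assert (Hz1 := Rlt_le_trans _ _ _ Hz (Rmin_l _ _)).
    assert (Hz2 := Rlt_le_trans _ _ _ Hz (Rmin_r _ _)).
    destruct (H' z) as [G1 G2].
    { assert (T := Cmod_sub_triangle c'' z c'). lra. }
    split; auto. constructor; auto. unfold on_line; simpl. intros E.
    destruct (Cmod_sub_bounds c'' z) as [B1 [B2 _]]. rewrite Cmod_sub_comm in B1, B2.
    assert (Ev : v = a * (fst c'' - fst z) + b * (snd c'' - snd z)) by (unfold v; lra).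
    assert (Hle : Rabs v <= S * Cmod (z - c'')).
    { rewrite Ev. eapply Rle_trans; [apply Rabs_triang|]. rewrite !Rabs_mult. unfold S.
      rewrite Rmult_plus_distr_r.
      apply Rplus_le_compat; apply Rmult_le_compat_l; auto; apply Rabs_pos. }
    apply (Rmult_lt_compat_l S) in Hz2; auto.
    replace (S * (Rabs v / S)) with (Rabs v) in Hz2 by (field; lra). lra.
Qed.

(** The lines join p to the points of F other than p; off them, the line through p and p' meets F at
    most in p. The vertical line through p, added in the base case, forces p' to differ from p. All
    nonzero x are allowed so that segments can be read from either end. *)
Lemma pencil (p : C) (F : list C) : exists ls, List.Forall proper_line ls /\
  forall p', List.Forall (fun l => ~ on_line l p') ls ->
    p' <> p /\ forall x : R, x <> 0 -> ~ In (p + x * (p' - p))%C F.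
Proof.
  induction F as [|w F [ls [Hls H]]].
  - exists (((1, 0), fst p) :: nil). split.
    + constructor; auto. left; simpl; lra.
    + intros p' Hp'. split; [|intros x Hx []]. intros ->.
      inversion Hp' as [|? ? H1 _]. apply H1. unfold on_line; simpl. ring.
  - destruct (classic (w = p)) as [->|Hwp].
    + exists ls. split; auto. intros p' Hp'. destruct (H p' Hp') as [H1 H2]. split; auto.
      intros x Hx [E|Hin]; [|now apply (H2 x)]. apply H1.
      assert (E' : (RtoC x * (p' - p))%C = 0).
      { replace (RtoC x * (p' - p))%C with (p + x * (p' - p) - p)%C by ring.
        rewrite <- E. ring. }
      assert (Hx' : RtoC x <> 0) by (intros K; apply Hx, RtoC_inj, K).
      replace p' with (/ x * (x * (p' - p)) + p)%C by (field; auto). rewrite E'. ring.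
    + set (a := snd w - snd p). set (b := - (fst w - fst p)).
      exists (((a, b), a * fst p + b * snd p) :: ls). split.
      * constructor; auto. unfold proper_line; simpl.
        destruct (Req_dec a 0) as [Ea|Ea]; auto. right. intros Eb. apply Hwp.
        apply injective_projections; unfold a, b in *; lra.
      * intros p' Hp'. inversion Hp' as [|? ? H1 H3]. subst.
        destruct (H p' H3) as [H2 H4]. split; auto.
        intros x Hx [E|Hin]; [|now apply (H4 x)].
        apply H1. unfold on_line, a, b. rewrite E. simpl. ring.
Qed.

(** With Lipschitz constant 1 the duration bounds the length, so lengths can be tracked in [reach]
    without [path_length]. *)
Definition lip1 (sigma : R -> C) (s t : R) : Prop :=
  forall u v, s <= u <= t -> s <= v <= t -> Cmod (sigma u - sigma v) <= Rabs (u - v).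

Lemma lip1_pcont sigma s t : lip1 sigma s t -> pcont sigma s t.
Proof.
  intros H. apply (lip_pcont _ _ _ 1); [lra|]. intros. rewrite Rmult_1_l. now apply H.
Qed.

Definition concat_path (l : R) (sigma tau : R -> C) (t : R) : C :=
  if Rle_dec t l then sigma t else tau t.

Lemma concat_path_left l sigma tau t : t <= l -> concat_path l sigma tau t = sigma t.
Proof. intros H. unfold concat_path. destruct (Rle_dec t l); [auto | lra]. Qed.

Lemma concat_path_right l sigma tau t : sigma l = tau l -> l <= t ->
  concat_path l sigma tau t = tau t.
Proof.
  intros E H. unfold concat_path. destruct (Rle_dec t l); auto. replace t with l by lra. auto.
Qed.

Lemma lip1_concat sigma tau s l t : s <= l <= t -> sigma l = tau l ->
  lip1 sigma s l -> lip1 tau l t -> lip1 (concat_path l sigma tau) s t.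
Proof.
  intros Hl E H1 H2.
  assert (H : forall u v, s <= u <= t -> s <= v <= t -> u <= v ->
    Cmod (concat_path l sigma tau u - concat_path l sigma tau v) <= Rabs (u - v)).
  { intros u v Hu Hv Huv. destruct (Rle_dec v l) as [Hvl|Hvl].
    - rewrite !concat_path_left by lra. apply H1; lra.
    - rewrite (concat_path_right _ _ _ v) by (auto; lra). destruct (Rle_dec u l) as [Hul|Hul].
      + rewrite concat_path_left by lra.
        eapply Rle_trans; [apply (Cmod_sub_triangle (sigma l))|].
        assert (h1 := H1 u l ltac:(lra) ltac:(lra)). assert (h2 := H2 l v ltac:(lra) ltac:(lra)).
        rewrite <- E in h2. rewrite (Rabs_left1 (u - l)) in h1 by lra.
        rewrite (Rabs_left1 (l - v)) in h2 by lra. rewrite (Rabs_left1 (u - v)) by lra. lra.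
      + rewrite concat_path_right by (auto; lra). apply H2; lra. }
  intros u v Hu Hv. destruct (Rle_dec u v) as [Huv|Huv]; [now apply H|].
  rewrite Cmod_sub_comm, Rabs_minus_sym. apply H; auto; lra.
Qed.

(* Germs h at p obtained from h0 at 0 by continuation along a path of length at most l
   that avoids F except possibly at its origin. *)
Definition reach (F : list C) (h0 : C -> C) (p : C) (h : C -> C) (l : R) : Prop :=
  0 <= l /\ exists sigma G q, lip1 sigma 0 l /\ sigma 0 = RtoC 0 /\ sigma l = p /\
    (forall t, 0 < t <= l -> ~ In (sigma t) F) /\ germ_family sigma 0 l G q /\
    near_eq (G 0) h0 0 /\ near_eq (G l) h p.

Lemma reach_origin F h r : 0 < r -> holo_on_disc h 0 r -> reach F h 0 h 0.
Proof.
  intros Hr Hh. split; [lra|].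
  assert (L : lip1 (fun _ => RtoC 0) 0 0).
  { intros u v _ _. rewrite Cmod_sub_self. apply Rabs_pos. }
  exists (fun _ => RtoC 0), (fun _ => h), (fun _ => r - Cmod (0 - 0)).
  split; [auto|]. split; [auto|]. split; [auto|]. split; [intros; lra|].
  split; [|split; apply near_eq_refl].
  apply (germ_family_const (fun _ => RtoC 0) 0 0 h 0 r); auto; [now apply lip1_pcont|].
  intros. rewrite Cmod_sub_self. auto.
Qed.

Lemma reach_near_eq F h0 p h h' l : reach F h0 p h l -> near_eq h h' p -> reach F h0 p h' l.
Proof.
  intros [Hl [s [G [q [H1 [H2 [H3 [H4 [H5 [H6 H7]]]]]]]]]] Hn. split; auto.
  exists s, G, q. do 6 (split; [assumption|]). now apply near_eq_trans with h.
Qed.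

(** Discs are convex, so the constant family h continues along the segment, traversed at unit speed.
    Its start x = 0 is exempt from avoiding F, since p may be the origin. *)
Lemma reach_segment F h0 p h l p' c r : reach F h0 p h l -> holo_on_disc h c r ->
  Cmod (p - c) < r -> Cmod (p' - c) < r -> p' <> p ->
  (forall x : R, 0 < x <= 1 -> ~ In (p + x * (p' - p))%C F) ->
  reach F h0 p' h (l + Cmod (p' - p)).
Proof.
  intros [Hl [s [G [q [H1 [H2 [H3 [H4 [H5 [H6 H7]]]]]]]]]] Hh Hp Hp' Hne HF.
  set (m := Cmod (p' - p)).
  assert (Hm : 0 < m).
  { apply Cmod_gt_0. intros E. apply Hne. replace p' with (p' - p + p)%C by ring. rewrite E. ring. }
  set (tau := fun t => (p + RtoC ((t - l) / m) * (p' - p))%C).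
  assert (Lt : lip1 tau l (l + m)).
  { intros u v _ _. unfold tau. right.
    replace (p + RtoC ((u - l) / m) * (p' - p) - (p + RtoC ((v - l) / m) * (p' - p)))%C
      with (RtoC ((u - v) / m) * (p' - p))%C
      by (unfold Rdiv, Rminus; rewrite !RtoC_mult, !RtoC_plus, !RtoC_opp; ring).
    rewrite Cmod_mult, Cmod_R. fold m. unfold Rdiv.
    rewrite Rabs_mult, (Rabs_pos_eq (/ m)) by (left; now apply Rinv_0_lt_compat).
    field. lra. }
  assert (E : s l = tau l).
  { unfold tau. rewrite H3. replace ((l - l) / m) with 0 by (field; lra). ring. }
  set (s' := concat_path l s tau).
  assert (Ls : lip1 s' 0 (l + m)) by (apply lip1_concat; auto; lra).
  assert (Gt : germ_family tau l (l + m) (fun _ => h) (fun u => r - Cmod (tau u - c))).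
  { apply germ_family_const; auto; [now apply lip1_pcont|]. intros u Hu. unfold tau.
    set (x := (u - l) / m).
    assert (Hx : 0 <= x <= 1).
    { unfold x; split.
      - apply Rmult_le_pos; [lra|]. left; now apply Rinv_0_lt_compat.
      - apply Rmult_le_reg_r with m; auto. unfold Rdiv. rewrite Rmult_assoc, Rinv_l; lra. }
    replace (p + x * (p' - p) - c)%C with (RtoC (1 - x) * (p - c) + x * (p' - c))%C
      by (unfold Rminus; rewrite RtoC_plus, RtoC_opp; ring).
    eapply Rle_lt_trans; [apply Cmod_triangle|].
    rewrite !Cmod_mult, !Cmod_R, !Rabs_pos_eq by lra.
    destruct (Req_dec x 0) as [->|Hx0]; [lra|].
    assert ((1 - x) * Cmod (p - c) <= (1 - x) * r) by (apply Rmult_le_compat_l; lra).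
    assert (x * Cmod (p' - c) < x * r) by (apply Rmult_lt_compat_l; lra). lra. }
  split; [lra|].
  exists s', (fun x => if Rle_dec x l then G x else h),
    (fun x => if Rle_dec x l then q x else r - Cmod (tau x - c)).
  assert (E' : s' (l + m) = p').
  { unfold s'. rewrite concat_path_right by (auto; lra). unfold tau.
    replace ((l + m - l) / m) with 1 by (field; lra). ring. }
  split; [auto|]. split; [unfold s'; rewrite concat_path_left; auto|].
  split; [auto|]. split.
  { intros t Ht. unfold s'. destruct (Rle_dec t l) as [Htl|Htl].
    - rewrite concat_path_left by auto. apply H4; lra.
    - rewrite concat_path_right by (auto; lra). apply HF. split.
      + apply Rdiv_lt_0_compat; lra.
      + apply Rmult_le_reg_r with m; auto. unfold Rdiv. rewrite Rmult_assoc, Rinv_l; lra. }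
  split.
  { apply (germ_family_concat s' 0 l (l + m) G q (fun _ => h)); try lra.
    - now apply lip1_pcont.
    - apply (germ_family_ext s); auto. intros u Hu. unfold s'. now rewrite concat_path_left.
    - apply (germ_family_ext tau); auto. intros u Hu. unfold s'. now rewrite concat_path_right.
    - unfold s'. rewrite concat_path_left, H3 by lra. auto. }
  split.
  { destruct (Rle_dec 0 l); [auto | lra]. }
  destruct (Rle_dec (l + m) l); [lra | apply near_eq_refl].
Qed.

(** The new vertex is chosen near the target g in general position twice: off the pencil at p, so
    that the edge misses F, and off [ls], for the benefit of a later edge. *)
Lemma reach_step F h0 p h l c r g ls eta : reach F h0 p h l -> holo_on_disc h c r ->
  Cmod (p - c) < r -> Cmod (g - c) < r -> List.Forall proper_line ls -> 0 < eta ->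
  exists p', Cmod (p' - g) < eta /\ List.Forall (fun l => ~ on_line l p') ls /\
    reach F h0 p' h (l + Cmod (p' - p)).
Proof.
  intros HR Hh Hp Hg Hls Heta.
  destruct (pencil p F) as [ls' [Hls' HP]].
  destruct (ball_avoiding_lines (ls ++ ls')) with (c := g) (eta := Rmin eta (r - Cmod (g - c)))
    as [p' [e [He H]]].
  - now apply List.Forall_app.
  - apply Rmin_glb_lt; lra.
  - destruct (H p') as [H1 H2]; [rewrite Cmod_sub_self; auto|].
    apply List.Forall_app in H2. destruct H2 as [H2 H3]. destruct (HP p' H3) as [H4 H5].
    assert (A1 := Rlt_le_trans _ _ _ H1 (Rmin_l _ _)).
    assert (A2 := Rlt_le_trans _ _ _ H1 (Rmin_r _ _)).
    exists p'. split; auto. split; auto.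
    apply (reach_segment F h0 p h l p' c r); auto.
    + assert (T := Cmod_sub_triangle g p' c). lra.
    + intros x Hx. apply H5. lra.
Qed.

(** Interval induction on the end time: passing between close times u and v costs one edge inside
    the disc of [f u]. The lines [ls] are arbitrary so that p can be put in general position for a
    further edge; the induction itself calls its hypothesis with [nil]. *)
Lemma polygon_near gamma T f r F : in_Pi gamma T -> germ_family gamma 0 T f r ->
  forall ls eta, List.Forall proper_line ls -> 0 < eta ->
  exists p l, Cmod (p - gamma T) < eta /\ List.Forall (fun l => ~ on_line l p) ls /\
    reach F (f 0) p (f T) l /\ l <= path_length gamma T + eta.
Proof.
  intros HPi [F1 F2]. assert (HPi' := HPi). destruct HPi' as [HT [HL Hg0]].
  apply (interval_induction (fun t => forall ls eta, List.Forall proper_line ls -> 0 < eta ->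
    exists p l, Cmod (p - gamma t) < eta /\ List.Forall (fun l => ~ on_line l p) ls /\
      reach F (f 0) p (f t) l /\ l <= path_length gamma t + eta) 0 T HT).
  - intros ls eta Hls Heta. destruct (F1 0) as [Hr Hh]; [lra|]. rewrite Hg0 in *.
    assert (R0 := reach_origin F (f 0) (r 0) Hr Hh).
    destruct (reach_step _ _ _ _ _ _ _ 0 ls eta R0 Hh) as [p' [P1 [P2 P3]]]; auto;
      try (rewrite Cmod_sub_self; auto).
    exists p', (0 + Cmod (p' - 0)). split; auto. split; auto. split; auto.
    assert (h := path_length_ge_0 gamma T 0 HL ltac:(lra)). lra.
  - intros u Hu. destruct (F1 u Hu) as [Hr Hh]. destruct (F2 u Hu) as [d [Hd H]].
    exists d; split; auto. intros v Hv Hvu. destruct (H v Hv Hvu) as [Hvr Hn].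
    destruct (near_eq_open _ _ _ Hn) as [e [He Hopen]].
    split; intros Huv HP ls eta Hls Heta.
    (* The old vertex p is taken so close to [gamma v] that [f v] and [f u] have the same germ there
       and p lies in the disc of [f u]. The thirds of eta cover the excess of the old polygon and
       the distances of both vertices from the path; the chord is paid for by [path_length_add]. *)
    + destruct (HP nil (Rmin (eta / 3) (Rmin e (r u - Cmod (gamma v - gamma u)))))
        as [p [l [P1 [_ [P3 P4]]]]]; [constructor | repeat apply Rmin_glb_lt; lra |].
      assert (A1 := Rlt_le_trans _ _ _ P1 (Rmin_l _ _)).
      assert (A := Rlt_le_trans _ _ _ P1 (Rmin_r _ _)).
      assert (A2 := Rlt_le_trans _ _ _ A (Rmin_l _ _)).
      assert (A3 := Rlt_le_trans _ _ _ A (Rmin_r _ _)).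
      assert (P4' := Rle_trans _ _ _ P4 (Rplus_le_compat_l _ _ _ (Rmin_l _ _))).
      apply (reach_near_eq _ _ _ _ (f u)) in P3; [|now apply Hopen].
      destruct (reach_step _ _ _ _ _ _ _ (gamma u) ls (eta / 3) P3 Hh) as [p' [Q1 [Q2 Q3]]]; auto.
      { assert (T1 := Cmod_sub_triangle (gamma v) p (gamma u)). unfold Cminus in *. lra. }
      { rewrite Cmod_sub_self. auto. }
      { lra. }
      exists p', (l + Cmod (p' - p)). split; [lra|]. split; auto. split; auto.
      assert (T1 := Cmod_sub_triangle (gamma u) p' p).
      assert (T2 := Cmod_sub_triangle (gamma v) (gamma u) p).
      rewrite (Cmod_sub_comm (gamma v) p) in T2.
      assert (G := path_length_add gamma T v u HL ltac:(lra) ltac:(lra)). lra.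
    + destruct (HP nil (Rmin (eta / 3) (r u))) as [p [l [P1 [_ [P3 P4]]]]];
        [constructor | apply Rmin_glb_lt; lra |].
      assert (A1 := Rlt_le_trans _ _ _ P1 (Rmin_l _ _)).
      assert (A2 := Rlt_le_trans _ _ _ P1 (Rmin_r _ _)).
      assert (P4' := Rle_trans _ _ _ P4 (Rplus_le_compat_l _ _ _ (Rmin_l _ _))).
      destruct (reach_step _ _ _ _ _ _ _ (gamma v) ls (Rmin (eta / 3) e) P3 Hh A2 Hvr Hls)
        as [p' [Q1 [Q2 Q3]]]; [apply Rmin_glb_lt; lra|].
      assert (B1 := Rlt_le_trans _ _ _ Q1 (Rmin_l _ _)).
      assert (B2 := Rlt_le_trans _ _ _ Q1 (Rmin_r _ _)).
      exists p', (l + Cmod (p' - p)). split; [lra|]. split; auto. split.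
      { apply (reach_near_eq _ _ _ _ (f v)) in Q3; auto. now apply near_eq_sym, Hopen. }
      assert (T1 := Cmod_sub_triangle (gamma v) p' p).
      assert (T2 := Cmod_sub_triangle (gamma u) (gamma v) p).
      rewrite (Cmod_sub_comm (gamma u) p) in T2.
      assert (G := path_length_add gamma T u v HL ltac:(lra) ltac:(lra)). lra.
Qed.

(** The pencil at [gamma T] is fixed before p is chosen off it, so the last edge, read backwards
    from [gamma T], can meet F only at its end point, which is not in F by hypothesis. *)
Lemma polygon_exact gamma T f r F eta : in_Pi gamma T -> germ_family gamma 0 T f r ->
  ~ In (gamma T) F -> 0 < eta ->
  exists l, reach F (f 0) (gamma T) (f T) l /\ l <= path_length gamma T + eta.
Proof.
  intros HPi HF HT Heta. destruct (pencil (gamma T) F) as [ls [Hls HP]].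
  assert (H0 : 0 <= T) by apply HPi. destruct (proj1 HF T) as [Hr Hh]; [lra|].
  destruct (polygon_near gamma T f r F HPi HF ls (Rmin (eta / 2) (r T)))
    as [p [l [P1 [P2 [P3 P4]]]]]; auto; [apply Rmin_glb_lt; lra|].
  assert (A1 := Rlt_le_trans _ _ _ P1 (Rmin_l _ _)).
  assert (A2 := Rlt_le_trans _ _ _ P1 (Rmin_r _ _)).
  assert (P4' := Rle_trans _ _ _ P4 (Rplus_le_compat_l _ _ _ (Rmin_l _ _))).
  destruct (HP p P2) as [Hne Hav].
  exists (l + Cmod (gamma T - p)). split; [|rewrite Cmod_sub_comm; lra].
  apply (reach_segment F (f 0) p (f T) l (gamma T) (gamma T) (r T)); auto.
  - rewrite Cmod_sub_self. auto.
  - intros x Hx. replace (p + x * (gamma T - p))%C with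
      (gamma T + RtoC (1 - x) * (p - gamma T))%C
      by (unfold Rminus; rewrite RtoC_plus, RtoC_opp; ring).
    destruct (Req_dec x 1) as [->|Hx1].
    + replace (1 - 1) with 0 by ring. replace (gamma T + 0 * (p - gamma T))%C with (gamma T) by ring. auto.
    + apply Hav. lra.
Qed.

(** * Singular points of the continuations of a germ *)

Lemma finite_subset (F : list C) (A : C -> Prop) : (forall w, A w -> In w F) -> finite_set A.
Proof.
  revert A. induction F as [|x F IH]; intros A HA.
  - exists nil. intros w. split; [apply HA | intros []].
  - destruct (IH (fun w => A w /\ w <> x)) as [l Hl].
    { intros w [Hw Hne]. destruct (HA w Hw) as [E|Hin]; auto. congruence. }
    destruct (classic (A x)) as [Hx|Hx].
    + exists (x :: l). intros w. simpl. rewrite <- Hl.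
      destruct (classic (w = x)) as [->|Hne]; [tauto|].
      split; [tauto|]. intros [E|H]; [congruence | tauto].
    + exists l. intros w. rewrite <- Hl. split; [|tauto]. intros Hw. split; auto.
      intros ->; auto.
Qed.

Lemma dist_to_list (w : C) (F : list C) : ~ In w F ->
  exists rho, 0 < rho /\ forall w', In w' F -> rho <= Cmod (w' - w).
Proof.
  induction F as [|x F IH]; intros Hw.
  - exists 1. split; [lra | intros w' []].
  - destruct IH as [rho [Hr H]]; [intros Hin; apply Hw; now right|].
    assert (Hx : 0 < Cmod (x - w)).
    { apply Cmod_gt_0. intros E. apply Hw. left.
      replace x with (x - w + w)%C by ring. rewrite E. ring. }
    exists (Rmin rho (Cmod (x - w))). split; [now apply Rmin_glb_lt|].
    intros w' [<-|Hin]; [apply Rmin_r|]. eapply Rle_trans; [apply Rmin_l | auto].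
Qed.

Lemma path_length_0 gamma T : in_Pi gamma T -> path_length gamma 0 <= 0.
Proof.
  intros [HT [[K HK] _]]. replace 0 with (K * 0) at 2 by ring.
  apply path_length_le_lip; [lra|]. intros u v Hu Hv. apply HK; lra.
Qed.

(* Continuation along a short segment avoiding F yields, at time 0, a function that is
   holomorphic near 0 and represents the series. *)
Lemma endlessly_continuable_germ a : endlessly_continuable a ->
  exists f0 r0, 0 < r0 /\ holo_on_disc f0 0 r0 /\ is_germ_of a f0.
Proof.
  intros Ha. destruct (Ha 1 Rlt_0_1) as [F HF].
  destruct (pencil 0 F) as [ls [Hls HP]].
  destruct (ball_avoiding_lines ls Hls 0 (1 / 2)) as [p [e [He H]]]; [lra|].
  destruct (H p) as [Hp1 Hp2]; [rewrite Cmod_sub_self; auto|].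
  destruct (HP p Hp2) as [_ Hav].
  replace (p - 0)%C with p in Hp1 by ring.
  set (gamma := fun t : R => (RtoC t * p)%C).
  assert (HL : forall u v, 0 <= u <= 1 -> 0 <= v <= 1 ->
    Cmod (gamma u - gamma v) <= Cmod p * Rabs (u - v)).
  { intros u v _ _. unfold gamma.
    replace (RtoC u * p - RtoC v * p)%C with (p * RtoC (u - v))%C
      by (unfold Rminus; rewrite RtoC_plus, RtoC_opp; ring).
    rewrite Cmod_mult, Cmod_R. lra. }
  assert (Hg0 : gamma 0 = RtoC 0) by (unfold gamma; ring).
  destruct (HF gamma) as [f [r [H1 [H2 _]]]].
  - split; [lra|]. split; auto. now exists (Cmod p).
  - eapply Rle_lt_trans; [apply (path_length_le_lip gamma (Cmod p)); auto; lra|]. lra.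
  - intros t Ht. replace (gamma t) with (0 + RtoC t * (p - 0))%C by (unfold gamma; ring).
    apply Hav. lra.
  - destruct (H1 0) as [Hr Hh]; [lra|]. rewrite Hg0 in Hh. exists (f 0), (r 0). auto.
Qed.

(** A path of length below r0 never leaves the disc of [f0], so the constant family works. *)
Lemma short_path_continuable a f0 r0 gamma T : holo_on_disc f0 0 r0 -> is_germ_of a f0 ->
  in_Pi gamma T -> path_length gamma T < r0 -> continuable_along a gamma T.
Proof.
  intros Hh Hg HPi Hlen. apply continuable_alongE.
  exists (fun _ => f0), (fun u => r0 - Cmod (gamma u - 0)). split; auto.
  apply germ_family_const; auto; [now apply in_Pi_pcont|].
  intros u Hu. replace (gamma u - 0)%C with (gamma u) by ring.
  eapply Rle_lt_trans; [now apply (Cmod_le_path_length gamma T)|].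
  eapply Rle_lt_trans; [|exact Hlen]. apply (path_length_mono gamma T); try lra. apply HPi.
Qed.

Lemma continuable_along_sub a gamma T t : 0 <= t <= T ->
  continuable_along a gamma T -> continuable_along a gamma t.
Proof.
  rewrite !continuable_alongE. intros Ht [f [r [H1 H2]]]. exists f, r. split; auto.
  apply (germ_family_sub gamma 0 T); auto; lra.
Qed.

(** The last germ [f t] lives on a disc in which the path remains for a while. *)
Lemma continuable_along_extend a gamma T t : in_Pi gamma T -> 0 <= t <= T ->
  continuable_along a gamma t -> exists d, 0 < d /\ forall u, t <= u <= T -> u - t < d ->
    continuable_along a gamma u.
Proof.
  rewrite continuable_alongE. intros HPi Ht [f [r [HF Hg]]].
  destruct (proj1 HF t) as [Hr Hh]; [lra|].
  destruct (in_Pi_pcont gamma T HPi t Ht (r t) Hr) as [d [Hd H]]. exists d; split; auto.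
  intros u Hu Hut. apply continuable_alongE. do 2 eexists. split.
  - apply (germ_family_concat gamma 0 t u f r (fun _ => f t)
      (fun v => r t - Cmod (gamma v - gamma t))); try lra; auto.
    + apply in_Pi_pcont. apply (in_Pi_sub gamma T); auto; lra.
    + assert (Hc := in_Pi_pcont gamma T HPi).
      apply germ_family_const; auto.
      * intros x Hx eps He. destruct (Hc x ltac:(lra) eps He) as [d' [Hd' H']].
        exists d'; split; auto. intros v Hv. apply H'; lra.
      * intros v Hv. apply H; [lra|]. rewrite Rabs_pos_eq; lra.
    + apply near_eq_refl.
  - cbv beta. destruct (Rle_dec 0 t); [auto | lra].
Qed.

(** The bound [path_length gamma T <= lam], rather than an equality, makes the family increase with
    lam. *)
Definition singular_points (a : nat -> C) (lam : R) (w : C) : Prop :=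
  exists gamma T, in_Pi gamma T /\ path_length gamma T <= lam /\ gamma T = w /\
    (forall t, 0 <= t < T -> continuable_along a gamma t) /\ ~ continuable_along a gamma T.

Lemma singular_points_continuable a : endlessly_continuable a ->
  Omega_continuable (singular_points a) a.
Proof.
  intros Ha gamma T [HPi HM].
  destruct (endlessly_continuable_germ a Ha) as [f0 [r0 [Hr0 [Hh0 Hg0]]]].
  assert (H0 : 0 <= T) by apply HPi.
  apply (interval_induction (fun t => continuable_along a gamma t) 0 T H0).
  { apply (short_path_continuable a f0 r0); auto.
    - apply (in_Pi_sub gamma T); auto; lra.
    - eapply Rle_lt_trans; [now apply (path_length_0 gamma T) | auto]. }
  intros u Hu. destruct (classic (continuable_along a gamma u)) as [Hc|Hc].
  - destruct (continuable_along_extend a gamma T u HPi Hu Hc) as [d [Hd H]].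
    exists d; split; auto. intros v Hv Hvu. split; [auto|]. intros Huv _.
    apply H; [lra|]. apply Rabs_def2 in Hvu. lra.
  (* If continuation failed at u but at no earlier time, the pair of the length up to u and
     [gamma u] would lie in [S_Omega] itself. So it fails at some v0 < u, and the clauses hold
     vacuously between v0 and u. *)
  - assert (Hex : exists v0, 0 <= v0 < u /\ ~ continuable_along a gamma v0).
    { apply NNPP; intros HN. apply (HM u Hu). intros eps He.
      exists (path_length gamma u), (gamma u).
      rewrite Rminus_diag, Rabs_R0, Cmod_sub_self. repeat split; auto.
      - apply (path_length_ge_0 gamma T); auto. apply HPi.
      - exists gamma, u. split; [now apply (in_Pi_sub gamma T)|].
        split; [lra|]. split; auto. split; auto. intros t Ht. apply NNPP; intros HN'.
        apply HN. now exists t. }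
    destruct Hex as [v0 [Hv0 Hn]]. exists (u - v0); split; [lra|].
    intros v Hv Hvu. apply Rabs_def2 in Hvu. split; [|tauto]. intros _ Hcv.
    exfalso. apply Hn. apply (continuable_along_sub a gamma v); auto; lra.
Qed.

(* If w were not in F, the path leading to w could be replaced, up to a time T1 < T, by a
   polygon avoiding F with the same terminal germ, and then continued to w. *)
Lemma singular_points_subset a L lam F w : endlessly_continuable a ->
  (forall gamma, in_Pi gamma 1 -> path_length gamma 1 < L ->
    (forall t, 0 < t <= 1 -> ~ In (gamma t) F) -> continuable_along a gamma 1) ->
  lam < L -> singular_points a lam w -> In w F.
Proof.
  intros Ha HF HlamL [gamma [T [HPi [Hlen [Hw [Hpre Hnot]]]]]].
  apply NNPP; intros HwF. apply Hnot.
  destruct (endlessly_continuable_germ a Ha) as [f0 [r0 [Hr0 [Hh0 Hg0]]]].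
  assert (HPi' := HPi). destruct HPi' as [HT0 [HLip Hgam0]].
  (* With T = 0 there is no earlier time T1 to stop at, but then the path is trivially
     continuable. *)
  destruct (Req_dec T 0) as [HT|HT].
  { exfalso. apply Hnot, (short_path_continuable a f0 r0); auto. rewrite HT.
    eapply Rle_lt_trans; [now apply (path_length_0 gamma T) | auto]. }
  destruct (dist_to_list w F HwF) as [rho [Hrho Hdist]].
  destruct (lipschitz_pos gamma T HLip) as [K [HK HLK]].
  (* The tail from T1 stays within gap / 2 < rho of w, hence off F. It costs at most gap / 2 <= (L -
     lam) / 4, and the polygon exceeds the original length by at most (L - lam) / 4, so the total is
     below L. *)
  set (gap := Rmin rho ((L - lam) / 2)).
  assert (Hgap : 0 < gap) by (apply Rmin_glb_lt; lra).
  assert (Hgap1 : gap <= rho) by apply Rmin_l.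
  assert (Hgap2 : gap <= (L - lam) / 2) by apply Rmin_r.
  set (T1 := Rmax 0 (T - gap / (2 * K))).
  assert (HT1 : 0 <= T1 < T).
  { split; [apply Rmax_l|]. apply Rmax_lub_lt; [lra|].
    assert (0 < gap / (2 * K)) by (apply Rdiv_lt_0_compat; lra). lra. }
  assert (Hm : K * (T - T1) <= gap / 2).
  { assert (h := Rmax_r 0 (T - gap / (2 * K))). fold T1 in h.
    apply Rle_trans with (K * (gap / (2 * K))); [apply Rmult_le_compat_l; lra|].
    right. field. lra. }
  assert (Htail : forall t, T1 <= t <= T -> ~ In (gamma t) F).
  { intros t Ht Hin. specialize (Hdist _ Hin). rewrite <- Hw in Hdist.
    assert (h := HLK t T ltac:(lra) ltac:(lra)).
    rewrite Rabs_left1 in h by lra.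
    assert (K * (T - t) <= K * (T - T1)) by (apply Rmult_le_compat_l; lra). lra. }
  destruct (proj1 (continuable_alongE _ _ _) (Hpre T1 HT1)) as [f [r [Hfam Hgerm]]].
  assert (HPi1 : in_Pi gamma T1) by (apply (in_Pi_sub gamma T); auto; lra).
  destruct (polygon_exact gamma T1 f r F ((L - lam) / 4) HPi1 Hfam) as [l [HR Hl]];
    [apply Htail; lra | lra |].
  assert (Hlen1 := path_length_mono gamma T T1 T HLip ltac:(lra) ltac:(lra)).
  destruct HR as [Hl0 [s [G [q [S1 [S2 [S3 [S4 [S5 [S6 S7]]]]]]]]]].
  set (m := K * (T - T1)) in *.
  assert (Hm0 : 0 < m) by (apply Rmult_lt_0_compat; lra).
  (* The tail of the path, with time stretched by K to make it 1-Lipschitz; it lasts m = K (T -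
     T1). *)
  set (tau := fun t => gamma (T1 + (t - l) / K)).
  assert (Htau : forall t, l <= t <= l + m -> T1 <= T1 + (t - l) / K <= T).
  { intros t Ht. split.
    - assert (0 <= (t - l) / K); [|lra].
      apply Rmult_le_pos; [lra|]. left; now apply Rinv_0_lt_compat.
    - apply Rmult_le_reg_r with K; auto.
      replace ((T1 + (t - l) / K) * K) with (K * T1 + (t - l)) by (field; lra).
      unfold m in Ht. lra. }
  assert (Ltau : lip1 tau l (l + m)).
  { intros u v Hu Hv. unfold tau.
    eapply Rle_trans; [apply HLK|].
    - specialize (Htau u Hu). lra.
    - specialize (Htau v Hv). lra.
    - replace (T1 + (u - l) / K - (T1 + (v - l) / K)) with ((u - v) * / K) by (field; lra).
      rewrite Rabs_mult, (Rabs_pos_eq (/ K)) by (left; now apply Rinv_0_lt_compat).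
      right. field. lra. }
  assert (E : s l = tau l).
  { unfold tau. rewrite S3. f_equal. field. lra. }
  set (s' := concat_path l s tau). set (N := l + m).
  assert (Ls : lip1 s' 0 N) by (apply lip1_concat; auto; unfold N; lra).
  assert (HN : 0 < N < L) by (unfold N; lra).
  assert (Cs : pcont s' 0 N) by now apply lip1_pcont.
  assert (Hav : forall t, 0 < t <= N -> ~ In (s' t) F).
  { intros t Ht. unfold s'. destruct (Rle_dec t l) as [Htl|Htl].
    - rewrite concat_path_left by auto. apply S4. lra.
    - rewrite concat_path_right by (auto; lra). unfold tau. apply Htail, Htau.
      unfold N in Ht. lra. }
  (* Endless continuability speaks of paths on [0, 1], hence the rescaling, undone in [Gs]. *)
  set (gamma1 := fun x => s' (N * x)).
  assert (Hg1 : continuable_along a gamma1 1).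
  { assert (L1 : forall u v, 0 <= u <= 1 -> 0 <= v <= 1 ->
      Cmod (gamma1 u - gamma1 v) <= N * Rabs (u - v)).
    { intros u v Hu Hv. unfold gamma1. eapply Rle_trans; [apply Ls; nra|].
      replace (N * u - N * v) with (N * (u - v)) by ring.
      rewrite Rabs_mult, (Rabs_pos_eq N) by lra. lra. }
    apply HF.
    - split; [lra|]. split; [now exists N|]. unfold gamma1. rewrite Rmult_0_r.
      unfold s'. rewrite concat_path_left; auto.
    - eapply Rle_lt_trans; [apply (path_length_le_lip gamma1 N); auto; lra|]. lra.
    - intros t Ht. apply Hav. nra. }
  destruct (proj1 (continuable_alongE _ _ _) Hg1) as [g [q' [Gfam Ggerm]]].
  assert (Gs : germ_family s' 0 N (fun x => g (0 + / N * x)) (fun x => q' (0 + / N * x))).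
  { apply (germ_family_ext (fun x => gamma1 (0 + / N * x))).
    - intros u Hu. unfold gamma1. f_equal. field. lra.
    - apply germ_family_reparam; [now apply Rinv_0_lt_compat|].
      replace (0 + / N * 0) with 0 by ring. replace (0 + / N * N) with 1 by (field; lra). auto. }
  set (G' := fun x => g (0 + / N * x)) in *. set (Q' := fun x => q' (0 + / N * x)) in *.
  assert (Hs0 : s' 0 = RtoC 0) by (unfold s'; rewrite concat_path_left; auto).
  assert (Hsl : s' l = gamma T1) by (unfold s'; rewrite concat_path_left; auto; lra).
  (* Both families start at 0 with a germ representing the series, so they agree at the end of the
     polygon, where G carries the germ of [f T1]. *)
  assert (Hu : near_eq (G l) (G' l) (s' l)).
  { apply (germ_family_unique s' 0 l G q G' Q'); auto.
    - intros x Hx eps He. destruct (Cs x ltac:(unfold N; lra) eps He) as [d' [Hd' H']].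
      exists d'; split; auto. intros v Hv. apply H'; unfold N; lra.
    - apply (germ_family_ext s); auto. intros u Hu. unfold s'. rewrite concat_path_left; auto; lra.
    - apply (germ_family_sub s' 0 N); auto; unfold N; lra.
    - rewrite Hs0. apply near_eq_trans with (f 0); auto.
      apply (is_germ_of_unique a); auto. unfold G'.
      replace (0 + / N * 0) with 0 by ring. auto. }
  rewrite Hsl in Hu.
  (* The map x to b + K x inverts the time change in [tau]: it sends [T1, T] onto [l, N]. *)
  set (b := l - K * T1).
  assert (Gt : germ_family gamma T1 T (fun x => G' (b + K * x)) (fun x => Q' (b + K * x))).
  { apply (germ_family_ext (fun x => s' (b + K * x))).
    - intros u Hu'. unfold s'. rewrite concat_path_right; auto.
      + unfold tau. f_equal. unfold b. field. lra.
      + unfold b. assert (K * T1 <= K * u) by (apply Rmult_le_compat_l; lra). lra.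
    - apply germ_family_reparam; auto.
      replace (b + K * T1) with l by (unfold b; ring).
      replace (b + K * T) with N by (unfold b, N, m; ring).
      apply (germ_family_sub s' 0 N); auto; lra. }
  apply continuable_alongE. do 2 eexists. split.
  - apply (germ_family_concat gamma 0 T1 T f r (fun x => G' (b + K * x))
      (fun x => Q' (b + K * x)));
      [lra | now apply in_Pi_pcont | auto | exact Gt |].
    replace (b + K * T1) with l by (unfold b; ring).
    apply near_eq_trans with (G l); auto. now apply near_eq_sym.
  - cbv beta. destruct (Rle_dec 0 T1); [auto | lra].
Qed.

Lemma singular_points_dfs a : endlessly_continuable a -> dfs (singular_points a).
Proof.
  intros Ha. split; [|split].
  (* Length L itself is allowed here, while endless continuability asks for strictly less than its
     bound; any bound above L would do. *)
  - intros L HL. destruct (Ha (L + 1)) as [F HF]; [lra|].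
    apply (finite_subset F). intros w. apply (singular_points_subset a (L + 1) L); auto. lra.
  - intros L1 L2 w _ HL [gamma [T [H1 [H2 H3]]]]. exists gamma, T. split; auto. split; auto. lra.
  - destruct (endlessly_continuable_germ a Ha) as [f0 [r0 [Hr0 [Hh0 Hg0]]]].
    exists (r0 / 2). split; [lra|]. intros w [gamma [T [H1 [H2 [_ [_ H3]]]]]].
    apply H3, (short_path_continuable a f0 r0); auto. lra.
Qed.

(** For t > 0, points of [S_Omega] close to the pair of the length and [gamma t] have filtration
    below L, because the length is strictly below L; so they lie over F, at distance at least rho.
    At t = 0, where [gamma] may lie in F, they would have filtration below delta, where [Omega] is
    empty. *)
Lemma Omega_continuable_endlessly Omega a : dfs Omega -> Omega_continuable Omega a ->
  endlessly_continuable a.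
Proof.
  intros [Hfin [Hmono [delta [Hdelta Hempty]]]] Hc L HL.
  destruct (Hfin L) as [F HF]; [lra|]. exists F.
  intros gamma HPi Hlen Hav. apply Hc. split; auto. intros t Ht Hcl.
  assert (HLip : lipschitz_on gamma 1) by apply HPi.
  destruct (Req_dec t 0) as [->|Ht0].
  - destruct (Hcl delta Hdelta) as [lam [w [[Hlam HO] [Hd _]]]].
    apply (Hempty w). apply (Hmono lam); auto.
    assert (h := path_length_0 gamma 1 HPi). apply Rabs_def2 in Hd. lra.
  - destruct (dist_to_list (gamma t) F) as [rho [Hrho Hdist]]; [apply Hav; lra|].
    assert (h := path_length_mono gamma 1 t 1 HLip ltac:(lra) ltac:(lra)).
    destruct (Hcl (Rmin rho (L - path_length gamma t))) as [lam [w [[Hlam HO] [Hd Hdw]]]].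
    { apply Rmin_glb_lt; lra. }
    assert (A1 := Rlt_le_trans _ _ _ Hdw (Rmin_l _ _)).
    assert (A2 := Rlt_le_trans _ _ _ Hd (Rmin_r _ _)). apply Rabs_def2 in A2.
    assert (Hin : In w F) by (apply HF, (Hmono lam); auto; lra).
    specialize (Hdist w Hin). rewrite Cmod_sub_comm in Hdist. lra.
Qed.

Theorem theorem2p13 :
  (forall a : nat -> C,
     hatR a <-> exists Omega : R -> C -> Prop, dfs Omega /\ hatR_Omega Omega a) /\
  (forall phi : nat -> C,
     resurgent phi <-> exists Omega : R -> C -> Prop, dfs Omega /\ Omega_resurgent Omega phi).
Proof.
  assert (H : forall a : nat -> C,
     hatR a <-> exists Omega : R -> C -> Prop, dfs Omega /\ hatR_Omega Omega a).
  { intros a. split.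
    - intros [Hconv Ha]. exists (singular_points a). split; [now apply singular_points_dfs|].
      split; auto. now apply singular_points_continuable.
    - intros [Omega [HO [Hconv Hc]]]. split; auto. now apply (Omega_continuable_endlessly Omega). }
  (* By definition the second equivalence is the first one at [borel_part phi]. *)
  split; [exact H|]. intros phi. apply H.
Qed.
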